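(* For every MCFTG $G$ with terminal alphabet $\Sigma$ and every $\Delta\subseteq\Sigma$, there is a polynomial time algorithm that, on input $w\in\Delta^*$, outputs a regular tree grammar $H_w$ and an MCFTG $G_w$ such that \[L(H_w)=\{d\in L(G_{\mathrm{der}})\mid \mathrm{yd}_\Delta(\mathrm{val}(d))=w\}\quad\text{and}\quad L(G_w)=\{t\in L(G)\mid\mathrm{yd}_\Delta(t)=w\}.\] The degree of the polynomial (in the length of $w$; $G$ and $\Delta$ are fixed) is $\mu(G)\cdot(\theta(G)+1)\cdot(\lambda(G)+1)$. If $G$ is footed, then the degree is $2\cdot\mu(G)\cdot(\lambda(G)+1)$.
   Context: **Sequences and trees.** $\mathbb N_0$ is the set of nonnegative integers, $[n]=\{1,\dots,n\}$. $A^*$ (resp. $A^+$) is the set of finite (resp. nonempty finite) sequences over $A$; a sequence of length 1 is identified with its element; juxtaposition is concatenation; $\mathrm{occ}(w)$ is the set of elements occurring in the sequence $w$; $w$ is repetition-free if no element occurs twice in it. A ranked alphabet is a set $\Sigma$ with a rank map $\mathrm{rk}\colon\Sigma\to\mathbb N_0$ (applied elementwise to sequences); $\Sigma^{(k)}$ is the set of symbols of rank $k$. $T_\Sigma$ is the set of trees over $\Sigma$: the smallest set of strings over $\Sigma$ containing $\sigma t_1\cdots t_k$ (also written $\sigma(t_1,\dots,t_k)$) for all $\sigma\in\Sigma^{(k)}$ and $t_i\in T_\Sigma$. A forest is a finite sequence of trees. $X=\{x_1,x_2,\dots\}$ is a set of variables (of rank 0, disjoint from other alphabets), $X_k=\{x_1,\dots,x_k\}$.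 A pattern of rank $k$ over $\Sigma$ is a tree over $\Sigma\cup X_k$ in which each of $x_1,\dots,x_k$ occurs exactly once; $P_\Sigma(X_k)$ is the set of these and $P_\Sigma(X)=\bigcup_k P_\Sigma(X_k)$. For a forest $t$, $\mathrm{occ}_\Omega(t)$ is the set of symbols of $\Omega$ occurring in $t$; $t$ is uniquely $\Omega$-labeled if each symbol of $\Omega$ occurs at most once in $t$. For $\Delta\subseteq\Sigma$, $\mathrm{yd}_\Delta(t)$ is the string obtained from the string $t$ by erasing all symbols not in $\Delta$. A regular tree grammar over $\Omega$ is a context-free grammar generating a subset of $T_\Omega$ whose nonterminals have rank 0 and whose rules have the form $A\to\omega(A_1,\dots,A_k)$ with nonterminals $A,A_1,\dots,A_k$ and $\omega\in\Omega^{(k)}$. **Substitution.** For a repetition-free sequence of symbols $\sigma=(\sigma_1,\dots,\sigma_n)$ and patterns $u=(u_1,\dots,u_n)$ with $\mathrm{rk}(u)=\mathrm{rk}(\sigma)$, $t[\sigma\gets u]$ is obtained from $t$ by replacing, recursively, each subtree $\sigma_i(s_1,\dots,s_k)$ by $u_i$ in which $x_j$ is replaced by the transformed $s_j$ (componentwise on forests). For $\mathcal L=\{B_1,\dots,B_k\}$ with $B_1\cdots B_k$ repetition-free and forests $f(B_i)$ with $\mathrm{rk}(f(B_i))=\mathrm{rk}(B_i)$, $t[B\gets f(B)\mid B\in\mathcal L]$ means $t[B_1\cdots B_k\gets f(B_1)\cdots f(B_k)]$. **MCFTG.** A multiple context-free tree grammar (MCFTG) is $G=(N,\mathcal N,\Sigma,S,R)$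 where $N$ is a finite ranked alphabet of nonterminals; $\mathcal N\subseteq N^+$ is a finite set of repetition-free sequences (big nonterminals) with $\mathrm{occ}(A)\ne\mathrm{occ}(A')$ for distinct $A,A'\in\mathcal N$; $\Sigma$ is a finite ranked alphabet of terminals, disjoint from $N$, containing a symbol of rank at least 1; $S\in\mathcal N\cap N^{(0)}$ is the initial nonterminal; $R$ is a finite set of rules $A\to(u,\mathcal L)$ with $A\in\mathcal N$, $u\in P_{N\cup\Sigma}(X)^+$ a uniquely $N$-labeled forest with $\mathrm{rk}(u)=\mathrm{rk}(A)$, and $\mathcal L\subseteq\mathcal N$ (the links) such that the sets $\mathrm{occ}(B)$, $B\in\mathcal L$, are pairwise disjoint with union $\mathrm{occ}_N(u)$. The sets $L(G,A)$, $A\in\mathcal N$, are simultaneously the smallest sets of forests such that for every rule $A\to(u,\mathcal L)$ and all $f(B)\in L(G,B)$ ($B\in\mathcal L$), $u[B\gets f(B)\mid B\in\mathcal L]\in L(G,A)$. $L(G)=L(G,S)\subseteq T_\Sigma$. The multiplicity is $\mu(G)=\max\{|A|: A\in\mathcal N\}$; the width is $\theta(G)=\max\{\mathrm{rk}(C): C\in N\}$; the rule-width $\lambda(G)$ is the maximal number $|\mathcal L|$ of links of a rule. **Derivation trees.** For every rule fix a linear order on its links; a rule with $k$ links has rank $k$, so $R$ is a ranked alphabet. The sets $L(G_{\mathrm{der}},A)\subseteq T_R$ are the smallest sets such that $\rho(d_1,\dots,d_k)\in L(G_{\mathrm{der}},A)$ whenever $\rho=A\to(u,\{B_1,\dots,B_k\})\in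 R$ (links in their order) and $d_i\in L(G_{\mathrm{der}},B_i)$; and $\mathrm{val}(\rho(d_1,\dots,d_k))=u[B_i\gets\mathrm{val}(d_i)\mid 1\le i\le k]$. $L(G_{\mathrm{der}})=L(G_{\mathrm{der}},S)$. **Footed.** A pattern $t\in P_{N\cup\Sigma}(X_k)$ is footed if either $k=0$, or $k\ge1$ and $t$ has a node labeled by a symbol of $N\cup\Sigma$ of rank $k$ whose $i$-th child is labeled $x_i$ for every $i\in[k]$. An MCFTG is footed if for each rule $A\to((u_1,\dots,u_n),\mathcal L)$ all $u_j$ are footed. *)

(* Defs.v *)
(* Finite sets of symbols, big nonterminals and rules are given by sequences, *)
(* used through membership only; repetitions and order are irrelevant.        *)
From HB Require Import structures.
From mathcomp Require Import all_boot all_algebra.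

Set Implicit Arguments.
Unset Strict Implicit.
Unset Printing Implicit Defensive.

(* [Var i] is the variable x_(i+1): variables are numbered from 0.            *)
Inductive tree (F : Type) : Type :=
  | Var of nat
  | Node of F & seq (tree F).
Arguments Var {F} _.

Section TreeEq.
Variable F : Type.

Fixpoint tree_encode (t : tree F) : GenTree.tree (nat + F) :=
  match t with
  | Var i => GenTree.Leaf (inl i)
  | Node f ts => GenTree.Node 0 (GenTree.Leaf (inr f) :: map tree_encode ts)
  end.

Fixpoint tree_decode (t : GenTree.tree (nat + F)) : option (tree F) :=
  match t with
  | GenTree.Leaf (inl i) => Some (Var i)
  | GenTree.Node _ (GenTree.Leaf (inr f) :: ts) =>
      Some (Node f (pmap tree_decode ts))
  | _ => None
  end.

Lemma tree_encodeK : pcancel tree_encode tree_decode.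
Proof.
rewrite /pcancel; fix IH 1 => -[i|f ts] //=; congr (Some (Node f _)).
by elim: ts => //= t ts IHts; rewrite IH /= IHts.
Qed.
End TreeEq.

HB.instance Definition _ (F : eqType) :=
  Equality.copy (tree F) (pcan_type (@tree_encodeK F)).

Section Trees.
Variable F : Type.
Implicit Types (t : tree F) (u : seq (tree F)).

Fixpoint tvars t : seq nat :=
  match t with
  | Var i => [:: i]
  | Node _ ts => flatten (map tvars ts)
  end.

(* The tree as a string (prefix notation), without the variables.             *)
Fixpoint labels t : seq F :=
  match t with
  | Var _ => [::]
  | Node f ts => f :: flatten (map labels ts)
  end.

Definition flabels u : seq F := flatten (map labels u).

Fixpoint ranked (rk : F -> nat) t : bool :=
  match t with
  | Var _ => true
  | Node f ts => (size ts == rk f) && all (ranked rk) ts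
  end.

Definition prank t : nat := size (tvars t).

(* [pattern rk t]: t is a pattern, necessarily of rank [prank t].             *)
Definition pattern (rk : F -> nat) t : bool :=
  ranked rk t && perm_eq (tvars t) (iota 0 (prank t)).

(* First-order substitution of the i-th tree of ss for [Var i].               *)
Fixpoint plug (ss : seq (tree F)) t : tree F :=
  match t with
  | Var i => nth (Var i) ss i
  | Node f ts => Node f (map (plug ss) ts)
  end.
End Trees.

Fixpoint has_foot (F : eqType) (rk : F -> nat) (k : nat) (t : tree F) : bool :=
  match t with
  | Var _ => false
  | Node f ts => (rk f == k) && (ts == map Var (iota 0 k))
                 || has (has_foot rk k) ts
  end.

Definition footed_pattern (F : eqType) (rk : F -> nat) (t : tree F) : bool :=
  (prank t == 0) || has_foot rk (prank t) t.

Definition yd (Sg : finType) (Delta : {set Sg}) (u : seq (tree Sg)) : seq Sg :=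
  [seq a <- flabels u | a \in Delta].

(* Trees over N and Sigma are trees over the disjoint sum [NT + Sg].          *)
(* A rule A -> (u, L) is the triple (A, u, L), with L listed in its fixed     *)
(* linear order.                                                              *)
Definition rule (NT : eqType) (Sg : eqType) : Type :=
  (seq NT * seq (tree (NT + Sg)) * seq (seq NT))%type.

Definition lhs (NT Sg : eqType) (r : rule NT Sg) : seq NT := r.1.1.
Definition rhs (NT Sg : eqType) (r : rule NT Sg) : seq (tree (NT + Sg)) :=
  r.1.2.
Definition links (NT Sg : eqType) (r : rule NT Sg) : seq (seq NT) := r.2.

(* The ranked alphabet N is the finite subset [nts] of the universe NT, with  *)
(* the ranks given by [ntrk]; the ranks of symbols outside [nts] are unused.  *)
Record mcftg (NT Sg : eqType) := MCFTG {
  nts : seq NT;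
  ntrk : NT -> nat;
  bigs : seq (seq NT);
  start : NT;
  rules : seq (rule NT Sg) }.

Section Mcftg.
Variables (NT Sg : eqType).
Implicit Types (t : tree (NT + Sg)) (u : seq (tree (NT + Sg))).

Definition ntocc u : seq NT :=
  pmap (fun f => if f is inl C then Some C else None) (flabels u).

Definition symrk (rk : Sg -> nat) (G : mcftg NT Sg) (f : NT + Sg) : nat :=
  match f with inl C => ntrk G C | inr a => rk a end.

Record is_rule (rk : Sg -> nat) (G : mcftg NT Sg) (r : rule NT Sg) : Prop := {
  rule_lhs : lhs r \in bigs G;
  rule_nonempty : rhs r != [::];
  rule_pattern : all (pattern (symrk rk G)) (rhs r);
  rule_symbols : {subset ntocc (rhs r) <= nts G};
  rule_unique : uniq (ntocc (rhs r));
  rule_rank : map (@prank _) (rhs r) = map (ntrk G) (lhs r);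
  rule_links : {subset links r <= bigs G};
  rule_links_uniq : uniq (links r);
  rule_links_disj : forall B B' C, B \in links r -> B' \in links r ->
    C \in B -> C \in B' -> B = B';
  rule_links_cover : flatten (links r) =i ntocc (rhs r) }.

Record is_mcftg (rk : Sg -> nat) (G : mcftg NT Sg) : Prop := {
  mcftg_bigs : {in bigs G, forall A,
    [/\ A != [::], uniq A & {subset A <= nts G}]};
  mcftg_bigs_occ : {in bigs G &, forall A A', A =i A' -> A = A'};
  mcftg_term : exists a, 0 < rk a;
  mcftg_start : [:: start G] \in bigs G;
  mcftg_start_rank : ntrk G (start G) = 0;
  mcftg_rules : {in rules G, forall r, is_rule rk G r};
  (* Links form a set: a rule occurs with a single linear order of its links. *)
  mcftg_link_order : {in rules G &, forall r r',
    lhs r = lhs r' -> rhs r = rhs r' -> links r =i links r' -> r = r'} }.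

(* t[sigma <- v]. Nonterminals outside sigma, where the result is a default   *)
(* value, do not occur in the right-hand side of a rule when sigma consists   *)
(* of its links.                                                              *)
Fixpoint subst (sigma : seq NT) (v : seq (tree Sg)) t : tree Sg :=
  match t with
  | Var i => Var i
  | Node (inl C) ts =>
      plug (map (subst sigma v) ts) (nth (Var 0) v (index C sigma))
  | Node (inr a) ts => Node a (map (subst sigma v) ts)
  end.

(* u[B_i <- v_i | i] for the sequence Bs of big nonterminals B_i and the      *)
(* sequence vs of forests v_i.                                                *)
Definition fsubst (Bs : seq (seq NT)) (vs : seq (seq (tree Sg))) u :
    seq (tree Sg) :=
  map (subst (flatten Bs) (flatten vs)) u.

Inductive lang (G : mcftg NT Sg) : seq NT -> seq (tree Sg) -> Prop :=
  | LangRule (r : rule NT Sg) (f : seq NT -> seq (tree Sg)) :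
      r \in rules G ->
      (forall B, B \in links r -> lang G B (f B)) ->
      lang G (lhs r) (fsubst (links r) (map f (links r)) (rhs r)).

Definition language (G : mcftg NT Sg) (t : tree Sg) : Prop :=
  lang G [:: start G] [:: t].

Definition mu (G : mcftg NT Sg) : nat := \max_(A <- bigs G) size A.
Definition theta (G : mcftg NT Sg) : nat := \max_(C <- nts G) ntrk G C.
Definition lambda (G : mcftg NT Sg) : nat := \max_(r <- rules G) size (links r).

Definition footed (rk : Sg -> nat) (G : mcftg NT Sg) : Prop :=
  {in rules G, forall r, all (footed_pattern (symrk rk G)) (rhs r)}.

Definition rule_arity (r : rule NT Sg) : nat := size (links r).

Inductive der (G : mcftg NT Sg) : seq NT -> tree (rule NT Sg) -> Prop :=
  | DerRule (r : rule NT Sg) (ds : seq (tree (rule NT Sg))) :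
      r \in rules G ->
      size ds = rule_arity r ->
      (forall i, i < rule_arity r ->
         der G (nth [::] (links r) i) (nth (Var 0) ds i)) ->
      der G (lhs r) (Node r ds).

Definition derivation (G : mcftg NT Sg) (d : tree (rule NT Sg)) : Prop :=
  der G [:: start G] d.

Fixpoint dval (d : tree (rule NT Sg)) : seq (tree Sg) :=
  match d with
  | Var _ => [::]
  | Node r ds => fsubst (links r) (map dval ds) (rhs r)
  end.
End Mcftg.

(* A rule (A, omega, [:: A_1; ...; A_k]) stands for A -> omega(A_1,...,A_k).  *)
Record rtg (NT Om : eqType) := RTG {
  rnts : seq NT;
  rstart : NT;
  rrules : seq (NT * Om * seq NT) }.

Section Rtg.
Variables (NT Om : eqType).

Record is_rtg (Omega : seq Om) (rk : Om -> nat) (H : rtg NT Om) : Prop := {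
  rtg_start : rstart H \in rnts H;
  rtg_rules : {in rrules H, forall r,
    [/\ r.1.1 \in rnts H, r.1.2 \in Omega, {subset r.2 <= rnts H}
      & size r.2 = rk r.1.2]} }.

Inductive rtg_lang (H : rtg NT Om) : NT -> tree Om -> Prop :=
  | RtgRule (r : NT * Om * seq NT) (ts : seq (tree Om)) :
      r \in rrules H ->
      size ts = size r.2 ->
      (forall i, i < size r.2 ->
         rtg_lang H (nth (rstart H) r.2 i) (nth (Var 0) ts i)) ->
      rtg_lang H r.1.1 (Node r.1.2 ts).

Definition rtg_language (H : rtg NT Om) (t : tree Om) : Prop :=
  rtg_lang H (rstart H) t.
End Rtg.

(* Programs of a random access machine with the uniform cost criterion:       *)
(* registers X_0, X_1, ... containing natural numbers, a read-only input tape *)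
(* and a write-only output tape of natural numbers, and, besides tests for    *)
(* zero, the Cook-Reckhow instruction set (no multiplication); jumps are      *)
(* replaced by conditionals and loops.                                        *)
Inductive program : Type :=
  | Skip
  | Cst of nat & nat            (* X_i := c *)
  | Plus of nat & nat & nat     (* X_i := X_j + X_k *)
  | Monus of nat & nat & nat    (* X_i := X_j - X_k, truncated at 0 *)
  | Fetch of nat & nat          (* X_i := X_(X_j) *)
  | Store of nat & nat          (* X_(X_i) := X_j *)
  | Read of nat                 (* X_i := next input, 0 if there is none *)
  | Print of nat                (* append X_i to the output *)
  | Seq of program & program
  | If of nat & program & program    (* if X_i > 0 *)
  | While of nat & program.          (* while X_i > 0 *)

Record state := State {
  regs : nat -> nat;
  input : seq nat;
  output : seq nat }.

Definition set_reg (s : state) (i x : nat) : state :=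
  State (fun j => if j == i then x else regs s j) (input s) (output s).

(* [exec P s s' n]: from state s, P halts in state s' after n steps, where    *)
(* every elementary instruction and every test counts as one step.            *)
Inductive exec : program -> state -> state -> nat -> Prop :=
  | ESkip s : exec Skip s s 1
  | ECst i c s : exec (Cst i c) s (set_reg s i c) 1
  | EPlus i j k s : exec (Plus i j k) s (set_reg s i (regs s j + regs s k)) 1
  | EMonus i j k s : exec (Monus i j k) s (set_reg s i (regs s j - regs s k)) 1
  | EFetch i j s : exec (Fetch i j) s (set_reg s i (regs s (regs s j))) 1
  | EStore i j s : exec (Store i j) s (set_reg s (regs s i) (regs s j)) 1
  | ERead i s :
      exec (Read i) s
        (set_reg (State (regs s) (behead (input s)) (output s))
                 i (head 0 (input s))) 1
  | EPrint i s :
      exec (Print i) s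
        (State (regs s) (input s) (rcons (output s) (regs s i))) 1
  | ESeq P Q s s' s'' m n :
      exec P s s' m -> exec Q s' s'' n -> exec (Seq P Q) s s'' (m + n)
  | EIfTrue i P Q s s' n :
      0 < regs s i -> exec P s s' n -> exec (If i P Q) s s' n.+1
  | EIfFalse i P Q s s' n :
      regs s i = 0 -> exec Q s s' n -> exec (If i P Q) s s' n.+1
  | EWhileTrue i P s s' s'' m n :
      0 < regs s i -> exec P s s' m -> exec (While i P) s' s'' n ->
      exec (While i P) s s'' (m + n).+1
  | EWhileFalse i P s :
      regs s i = 0 -> exec (While i P) s s 1.

Definition runs (P : program) (inp out : seq nat) (time : nat) : Prop :=
  exists2 s, exec P (State (fun=> 0) inp [::]) s time & output s = out.

(* Grammars are output in a prefix code: every list is written with a 1 in    *)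
(* front of each of its elements, and is terminated by 0.                     *)
Definition enc_seq (T : Type) (enc : T -> seq nat) (s : seq T) : seq nat :=
  flatten [seq 1 :: enc x | x <- s] ++ [:: 0].

(* Nonterminals of computed grammars are named by finite sequences of numbers. *)
Definition name := seq nat.

Definition enc_name (C : name) : seq nat := enc_seq (fun i => [:: i]) C.

(* 0 is kept for the end of the input.                                        *)
Definition enc_sym (Sg : finType) (a : Sg) : nat := (enum_rank a).+1.

Definition enc_word (Sg : finType) (w : seq Sg) : seq nat :=
  map (@enc_sym Sg) w.

Fixpoint enc_tree (Sg : finType) (t : tree (name + Sg)) : seq nat :=
  match t with
  | Var i => [:: 0; i]
  | Node (inl C) ts => 1 :: enc_name C ++ enc_seq (@enc_tree Sg) ts
  | Node (inr a) ts => 2 :: enc_sym a :: enc_seq (@enc_tree Sg) ts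
  end.

Definition enc_rule (Sg : finType) (r : rule name Sg) : seq nat :=
  enc_seq enc_name (lhs r) ++ enc_seq (@enc_tree Sg) (rhs r)
    ++ enc_seq (enc_seq enc_name) (links r).

Definition enc_mcftg (Sg : finType) (G : mcftg name Sg) : seq nat :=
  enc_seq (fun C => enc_name C ++ [:: ntrk G C]) (nts G)
    ++ enc_seq (enc_seq enc_name) (bigs G)
    ++ enc_name (start G)
    ++ enc_seq (@enc_rule Sg) (rules G).

(* The terminal omega, a member of Omega, is encoded by its position there.   *)
Definition enc_rtg (Om : eqType) (Omega : seq Om) (H : rtg name Om) : seq nat :=
  enc_seq enc_name (rnts H)
    ++ enc_name (rstart H)
    ++ enc_seq (fun r => enc_name r.1.1 ++ index r.1.2 Omega
                           :: enc_seq enc_name r.2) (rrules H).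

(* Main.v *)
From Stdlib Require Import IndefiniteDescription.
Require Import Defs.
From mathcomp Require Import all_boot all_algebra zify.

(* H_w and G_w are products of G with the automaton that reads w: a big       *)
(* nonterminal is annotated with the positions in w at which its components,  *)
(* and the gaps that these leave for their arguments, begin and end. Consider *)
(* a right-hand side of a rule as a string, cut into pieces at all the ends   *)
(* of nonterminals, arguments and variables. Once the position is known at    *)
(* which a piece begins, its letters determine where it ends, so that only    *)
(* the beginnings are free. Each nonterminal C of the rule, on the left-hand  *)
(* side or in a link, accounts for one free position plus one for every gap   *)
(* of C. There are rk(C) gaps, but at most one if G is footed, because the    *)
(* arguments of C then end up next to each other, in their order. Hence a     *)
(* rule has at most mu * (theta + 1) * (lambda + 1), or 2 * mu * (lambda + 1),*)
(* free positions. The program lets these run through 0, ..., |w| in nested   *)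
(* loops, compares the letters, and prints the resulting rule.                *)

(** Correctness rests on one fact about substitution. A value of a nonterminal, read with gaps in
    place of its arguments, leads the automaton from the first to the last position of its
    annotation ([spans]). In prefix notation, substitution replaces variables by strings
    ([tstr_plug], [glin_plug]), so substituting values into a right-hand side fills gaps. Hence runs
    over the rule's own string and over the values of its links combine into a run over the
    substituted forest ([lin_subst]). Conversely, such a run can be cut into these pieces, and since
    each nonterminal occurs once, its positions can be recorded without conflict ([lin_ex]).
    [inst_sound] and [inst_complete] transfer this to the enumerated instances, and induction on
    derivations gives [Hw_language] and [Gw_language], with the start nonterminal annotated by 0 and
    |w|.

    For the degree, a successful run determines every position from those at which reading resumes
    ([detsP]), and [size_free_places] counts the latter. In a footed grammar, substitution keeps the
    variables x_1, ..., x_k next to each other ([infix_tstr_subst]), so that one gap per nonterminal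
    is enough.

    For the time, all other positions are symbolic expressions in the free ones. The output thus
    consists of finitely many templates, independent of w. [blocks_run] compiles any list of
    templates into nested loops, and [blocks_out] identifies what the templates of G print. *)

Set Implicit Arguments.
Unset Strict Implicit.
Unset Printing Implicit Defensive.

(** * Programs that enumerate the instances of templates *)

(* The expression (i, c) stands for e_i + c, where the environment e starts   *)
(* with 0 and with the length of the input, so that (0, c) is a constant.     *)
Definition expr := (nat * nat)%type.
Definition ev (e : seq nat) (x : expr) : nat := nth 0 e x.1 + x.2.

(* The check (b, x, y) compares y with the value of x, or, if b holds, with   *)
(* the input letter at that position.                                         *)
Definition check := (bool * expr * expr)%type.
Definition passes (code e : seq nat) (c : check) : bool :=
  (if c.1.1 then nth 0 code (ev e c.1.2) else ev e c.1.2) == ev e c.2.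

(** Values come in decreasing order because the loop counter of the machine, which counts down to 0,
    is itself the loop variable. *)
Fixpoint envs (n m : nat) : seq (seq nat) :=
  if m is m'.+1 then [seq x :: e | x <- rev (iota 0 n.+1), e <- envs n m']
  else [:: [::]].

Lemma mem_envs n m e :
  (e \in envs n m) = (size e == m) && all (fun x => x <= n) e.
Proof.
elim: m e => [|m IH] e; first by case: e.
apply/allpairsP/idP => [[[x e'] []]|]; rewrite -[rev _]/(rev (iota 0 n.+1)).
  rewrite mem_rev mem_iota ltnS => xn; rewrite IH => /andP[se ae] ->.
  by apply/and3P; split.
case: e => // x e; rewrite eqSS => /and3P[se xn ae].
exists (x, e); split=> //; first by rewrite mem_rev mem_iota ltnS.
by rewrite IH; apply/andP; split.
Qed.

(* A template: number of loop variables, checks, and text to be printed.      *)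
Definition block := (nat * seq check * seq expr)%type.

Definition instance_out (code e : seq nat) (b : block) : seq nat :=
  if all (passes code e) b.1.2 then map (ev e) b.2 else [::].

Definition block_out (code : seq nat) (b : block) : seq nat :=
  flatten [seq instance_out code [:: 0, size code & e] b
          | e <- envs (size code) b.1.1].

Definition does (P : program) (s s' : state) (T : nat) : Prop :=
  exists2 t, exec P s s' t & t <= T.

Lemma does_seq P Q s s' s'' T T' :
  does P s s' T -> does Q s' s'' T' -> does (Seq P Q) s s'' (T + T').
Proof.
by move=> [t Et tT] [t' Et' tT']; exists (t + t'); [apply: ESeq Et Et'|lia].
Qed.

Lemma does_le P s s' T T' : does P s s' T -> T <= T' -> does P s s' T'.
Proof. by move=> [t Et tT] le; exists t => //; lia. Qed.

Definition upd (s s' : state) (i v : nat) : Prop :=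
  (forall j, regs s' j = if j == i then v else regs s j)
  /\ output s' = output s.

Lemma upd_set s i v : upd s (set_reg s i v) i v.
Proof. by split. Qed.

(* Registers 0-3 are scratch, the environment occupies the registers from 4   *)
(* on, and the input letters those from 4 + M on. The latter are never        *)
(* overrun, since unused registers contain 0, which is not a letter.          *)
Lemma flatten_map_allpairs (A B C D : Type) (g : C -> seq D) (f : A -> B -> C)
    (s : seq A) (t : A -> seq B) :
  flatten (map g [seq f x y | x <- s, y <- t x])
  = flatten [seq flatten [seq g (f x y) | y <- t x] | x <- s].
Proof. by elim: s => //= x s IH; rewrite map_cat flatten_cat IH -map_comp. Qed.

Section Templates.
Variables (M : nat) (code : seq nat).
Let n := size code.

Definition mem (e : seq nat) (s : state) : Prop :=
  [/\ size e <= M, forall j, j < size e -> regs s (4 + j) = nth 0 e j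
    & forall p, regs s (4 + M + p) = nth 0 code p].

(** An index outside the environment has value 0 in [ev]. This is decided when the program is
    generated, so that only registers of the environment are added. *)
Definition eval_prog (d i : nat) (x : expr) : program :=
  if x.1 < d then Seq (Cst i x.2) (Plus i i (4 + x.1)) else Cst i x.2.

Lemma upd_mem e s s' i v : i < 4 -> upd s s' i v -> mem e s -> mem e s'.
Proof.
move=> i4 [Hr _] [se H1 H2]; split=> // [j jd|p].
  by rewrite Hr ifN ?H1 //; apply/negP => /eqP; lia.
by rewrite Hr ifN ?H2 //; apply/negP => /eqP; lia.
Qed.

Lemma regs_set s i v j :
  regs (set_reg s i v) j = if j == i then v else regs s j.
Proof. by []. Qed.

Lemma mem_set e s i v : i < 4 -> mem e s -> mem e (set_reg s i v).
Proof. by move=> i4; apply: upd_mem i4 (upd_set s i v). Qed.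

Lemma eval_progP e s i x : i < 4 -> mem e s ->
  exists2 s', does (eval_prog (size e) i x) s s' 2 & upd s s' i (ev e x).
Proof.
case: x => k c i4 [se He Hc]; rewrite /eval_prog /ev /=.
case: ltnP => kd.
  exists (set_reg (set_reg s i c) i (c + regs s (4 + k))).
    rewrite -[2]/(1 + 1); apply: (@does_seq _ _ _ (set_reg s i c)).
      by exists 1 => //; apply: ECst.
    have k4 : (4 + k == i) = false by apply/negP => /eqP; lia.
    exists 1 => //; have := EPlus i i (4 + k) (set_reg s i c).
    by rewrite /= eqxx k4.
  by split=> //= j; rewrite He // addnC; case: eqP.
eexists; first by exists 1; first exact: ECst.
by rewrite nth_default // add0n; apply: upd_set.
Qed.

Definition print_prog (d : nat) (xs : seq expr) : program :=
  foldr (fun x P => Seq (Seq (eval_prog d 0 x) (Print 0)) P) Skip xs.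

Lemma print_progP e s xs : mem e s ->
  exists s', [/\ does (print_prog (size e) xs) s s' (3 * size xs).+1, mem e s'
    & output s' = output s ++ map (ev e) xs].
Proof.
elim: xs s => [|x xs IH] s He.
  by exists s; split=> //=; [exists 1 => //; apply: ESkip | rewrite cats0].
have [s1 D1 U1] := eval_progP x (isT : 0 < 4) He.
have He1 := upd_mem (isT : 0 < 4) U1 He.
pose s2 := State (regs s1) (input s1) (rcons (output s1) (regs s1 0)).
have He2 : mem e s2 by [].
have [s3 [D3 He3 O3]] := IH s2 He2.
exists s3; split=> //.
  apply: (@does_le _ _ _ (2 + 1 + (3 * size xs).+1)); last by rewrite /=; lia.
  apply: does_seq D3; apply: does_seq D1 _.
  by exists 1 => //; apply: EPrint.
by case: U1 => U1 O1; rewrite O3 /= U1 O1 eqxx cat_rcons.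
Qed.

Definition load_prog (d : nat) (fl : bool) (x : expr) : program :=
  if fl then
    Seq (eval_prog d 0 x) (Seq (Cst 1 (4 + M)) (Seq (Plus 0 0 1) (Fetch 0 0)))
  else eval_prog d 0 x.

(** Equality of u and v is tested as (u - v) + (v - u) = 0 with truncated subtraction. *)
Definition check_prog (d : nat) (c : check) (P : program) : program :=
  Seq (load_prog d c.1.1 c.1.2)
   (Seq (eval_prog d 1 c.2)
    (Seq (Monus 2 0 1) (Seq (Monus 1 1 0) (Seq (Plus 2 2 1) (If 2 Skip P))))).

Lemma load_progP e s fl x : mem e s ->
  exists2 s', does (load_prog (size e) fl x) s s' 5 & 
  mem e s' /\ output s' = output s
    /\ regs s' 0 = if fl then nth 0 code (ev e x) else ev e x.
Proof.
move=> He; have [s1 D1 U1] := eval_progP x (isT : 0 < 4) He.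
have He1 := upd_mem (isT : 0 < 4) U1 He; case: (U1) => R1 O1.
rewrite /load_prog; case: fl; last first.
  by exists s1; [apply: does_le D1 _ | rewrite R1].
set v := ev e x.
pose s2 := set_reg s1 1 (4 + M).
pose s3 := set_reg s2 0 (v + (4 + M)).
exists (set_reg s3 0 (nth 0 code v)).
  rewrite -[5]/(2 + (1 + (1 + 1))); apply: does_seq D1 _.
  apply: (@does_seq _ _ _ s2); first by exists 1 => //; apply: ECst.
  apply: (@does_seq _ _ _ s3).
    exists 1 => //; rewrite (_ : s3 = set_reg s2 0 (regs s2 0 + regs s2 1)).
      exact: EPlus.
    by rewrite /s3 /s2 /= R1.
  exists 1 => //; case: He => _ _ /(_ v) Hv.
  rewrite (_ : nth 0 code v = regs s3 (regs s3 0)); first exact: EFetch.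
  rewrite /s3 /s2 /= !ifN ?R1 ?ifN -?Hv //; last 3 first.
    by apply/negP => /eqP; lia.
    by apply/negP => /eqP; lia.
    by apply/negP => /eqP; lia.
  by rewrite addnC.
split; last by rewrite -O1.
by rewrite /s3 /s2; do 3!apply: mem_set => //.
Qed.

(** Of the 12 extra steps, 10 prepare the comparison and at most 2 are spent on the conditional and
    [Skip]. *)
Lemma check_progP e s c P T out : mem e s ->
  (forall s, mem e s -> exists s',
     [/\ does P s s' T, mem e s' & output s' = output s ++ out]) ->
  exists s', [/\ does (check_prog (size e) c P) s s' (T + 12), mem e s'
    & output s' = output s ++ if passes code e c then out else [::]].
Proof.
move=> He HP; case: c => [[fl x] y]; rewrite /check_prog /passes /=.
have [s1 D1 [He1 [O1 R1]]] := load_progP fl x He.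
have [s2 D2 U2] := eval_progP y (isT : 1 < 4) He1.
have He2 := upd_mem (isT : 1 < 4) U2 He1; case: U2 => R2 O2.
set u := (if fl then _ else _) in R1 *; set v := ev e y in R2 *.
pose s3 := set_reg s2 2 (u - v).
pose s4 := set_reg s3 1 (v - u).
pose s5 := set_reg s4 2 (u - v + (v - u)).
have He5 : mem e s5.
  by rewrite /s5 /s4 /s3; do 3!apply: mem_set => //.
have D5 s' T' : does (If 2 Skip P) s5 s' T' ->
  does (check_prog (size e) (fl, x, y) P) s s' (T' + 10).
  move=> D; apply: (@does_le _ _ _ (5 + (2 + (1 + (1 + (1 + T')))))); last lia.
  apply: does_seq D1 _; apply: does_seq D2 _.
  apply: (@does_seq _ _ _ s3).
    exists 1 => //; rewrite (_ : s3 = set_reg s2 2 (regs s2 0 - regs s2 1)).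
      exact: EMonus.
    by rewrite /s3 !R2 R1.
  apply: (@does_seq _ _ _ s4).
    exists 1 => //; rewrite (_ : s4 = set_reg s3 1 (regs s3 1 - regs s3 0)).
      exact: EMonus.
    by rewrite /s4 /s3 /= !R2 R1.
  apply: does_seq D; exists 1 => //.
  by rewrite (_ : s5 = set_reg s4 2 (regs s4 2 + regs s4 1)) //; apply: EPlus.
have R5 : regs s5 2 = u - v + (v - u) by [].
have O5 : output s5 = output s by rewrite /= O2.
case: eqP => uv.
  have [s6 [[t Et tT] He6 O6]] := HP s5 He5.
  exists s6; split=> //; last by rewrite O6 O5.
  apply: (@does_le _ _ _ (T.+1 + 10)); last lia.
  by apply: D5; exists t.+1 => //; apply: EIfFalse Et; rewrite R5; lia.
exists s5; split=> //; last by rewrite O5 cats0.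
apply: (@does_le _ _ _ (2 + 10)); last lia.
by apply: D5; exists 2 => //; apply: EIfTrue; [rewrite R5; lia | apply: ESkip].
Qed.

Definition body_prog (d : nat) (b : block) : program :=
  foldr (check_prog d) (print_prog d b.2) b.1.2.

Definition body_time (b : block) : nat := 12 * size b.1.2 + (3 * size b.2).+1.

Lemma body_progP e s b : mem e s ->
  exists s', [/\ does (body_prog (size e) b) s s' (body_time b), mem e s'
    & output s' = output s ++ instance_out code e b].
Proof.
case: b => [[m cs] xs]; rewrite /body_prog /body_time /instance_out /=.
elim: cs s => [|c cs IH] s He; first exact: print_progP.
have [s' [D He' O]] := check_progP c He IH.
exists s'; split=> //=; first by apply: does_le D _; lia.
by rewrite O; case: (passes _ _ _).
Qed.

(** Register 4 + d is both loop counter and entry d of the environment. It starts at n + 1 (register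
    5 holds n) and is decremented before the body, which therefore sees n, ..., 0. *)
Fixpoint nest_prog (d m : nat) (b : block) : program :=
  if m is m'.+1 then
    Seq (Cst 0 1) (Seq (Plus (4 + d) 5 0)
      (While (4 + d) (Seq (Cst 0 1)
         (Seq (Monus (4 + d) (4 + d) 0) (nest_prog d.+1 m' b)))))
  else body_prog d b.

(** The summand 10 * m absorbs the loop overhead: at each level, 3 steps per round and 3 more for
    the set-up and the last test. *)
Definition nest_time (m : nat) (b : block) : nat :=
  (body_time b + 10 * m) * n.+1 ^ m.

Lemma mem_rcons_set e s x : mem e s -> size e < M -> regs s (4 + size e) = x ->
  mem (rcons e x) s.
Proof.
move=> [se H1 H2] lt Hx; split=> //; rewrite size_rcons // => j.
rewrite nth_rcons ltnS leq_eqVlt; case: ltngtP => //= jd _; first exact: H1.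
by rewrite jd.
Qed.

Lemma nest_progP m e s b :
  1 < size e -> nth 0 e 1 = n -> size e + m <= M -> mem e s ->
  exists s', [/\ does (nest_prog (size e) m b) s s' (nest_time m b), mem e s'
    & output s' = output s
        ++ flatten [seq instance_out code (e ++ e') b | e' <- envs n m]].
Proof.
elim: m e s => [|m IH] e s e1 en eM He.
  have [s' [D He' O]] := body_progP b He; exists s'; split=> //=.
    by apply: does_le D _; rewrite /nest_time; lia.
  by rewrite !cats0.
set d := size e.
pose out x := flatten [seq instance_out code (rcons e x ++ e') b | e' <- envs n m].
(* Here x is the number of rounds left. The counter survives the body because the body preserves the
   environment extended by it. *)
have loop x s1 : x <= n.+1 -> mem e s1 -> regs s1 (4 + d) = x ->
  exists s', [/\ does (While (4 + d) (Seq (Cst 0 1)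
         (Seq (Monus (4 + d) (4 + d) 0) (nest_prog d.+1 m b)))) s1 s'
         (x * (nest_time m b + 3)).+1, mem e s'
    & output s' = output s1 ++ flatten [seq out y | y <- rev (iota 0 x)]].
  elim: x s1 => [|x IHx] s1 xn He1 Hx.
    exists s1; split=> //; last by rewrite cats0.
    by exists 1 => //; apply: EWhileFalse.
  pose s2 := set_reg s1 0 1.
  pose s3 := set_reg s2 (4 + d) x.
  have He2 : mem e s2 by apply: mem_set.
  have He3 : mem e s3.
    case: He2 => se H1 H2; split=> // [j jd|p].
      by rewrite /s3 regs_set ifN ?H1 //; apply/negP => /eqP; lia.
    by rewrite /s3 regs_set ifN ?H2 //; apply/negP => /eqP; lia.
  have Hx3 : regs s3 (4 + d) = x by rewrite /= eqxx.
  have He3' := mem_rcons_set He3 (_ : d < M) Hx3.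
  have [||||s4 [D4 He4 O4]] := IH (rcons e x) s3; rewrite ?size_rcons; try lia.
  - by rewrite nth_rcons e1.
  - by apply: He3'; lia.
  have He4' : mem e s4.
    case: He4; rewrite size_rcons => se H1 H2; split=> // [|j jd]; first lia.
    by rewrite H1 ?nth_rcons ?jd //; lia.
  have Hx4 : regs s4 (4 + d) = x.
    by case: He4 => _ /(_ d) -> //; rewrite ?size_rcons // nth_rcons ltnn eqxx.
  have [|||s5 [D5 He5 O5]] := IHx s4 => //; first lia.
  exists s5; split=> //.
    have DB : does (Seq (Cst 0 1)
         (Seq (Monus (4 + d) (4 + d) 0) (nest_prog d.+1 m b))) s1 s4
         (1 + (1 + nest_time m b)).
      apply: (@does_seq _ _ _ s2); first by exists 1 => //; apply: ECst.
      rewrite size_rcons in D4; apply: does_seq D4; exists 1 => //.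
      rewrite (_ : s3 = set_reg s2 (4 + d) (regs s2 (4 + d) - regs s2 0)).
        exact: EMonus.
      by rewrite /s3 /s2 /= Hx subn1.
    case: DB => t Et tT; case: D5 => t' Et' tT'.
    exists (t + t').+1; last by rewrite mulSn; lia.
    by apply: EWhileTrue Et Et'; rewrite Hx.
  rewrite O5 O4 -catA; congr (_ ++ _).
  by rewrite -addn1 iotaD rev_cat /= add0n.
pose s1 := set_reg s 0 1.
pose s2 := set_reg s1 (4 + d) n.+1.
have He2 : mem e s2.
  case: He => se H1 H2; split=> // [j jd|p].
    by rewrite /s2 /s1 !regs_set !ifN ?H1 //; apply/negP => /eqP; lia.
  by rewrite /s2 /s1 !regs_set !ifN ?H2 //; apply/negP => /eqP; lia.
have [|s3 [D3 He3 O3]] := loop n.+1 s2 (leqnn _) He2.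
  by rewrite /= eqxx.
exists s3; split=> //.
  apply: (@does_le _ _ _ (1 + (1 + (n.+1 * (nest_time m b + 3)).+1))).
    apply: (@does_seq _ _ _ s1); first by exists 1 => //; apply: ECst.
    apply: does_seq D3; exists 1 => //.
    rewrite (_ : s2 = set_reg s1 (4 + d) (regs s1 5 + regs s1 0)).
      exact: EPlus.
    case: He => se /(_ 1 e1) H1 _; rewrite /s2 /s1 /=.
    by rewrite -[5]/(4 + 1) H1 en addn1.
  rewrite /nest_time expnS.
  have : 0 < n.+1 ^ m by rewrite expn_gt0.
  move: (n.+1 ^ m) (body_time b) => z c; nia.
rewrite O3; congr (_ ++ _).
rewrite (_ : envs n m.+1 = [seq x :: e | x <- rev (iota 0 n.+1), e <- envs n m]) //.
rewrite flatten_map_allpairs.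
congr flatten; apply: eq_map => x; congr flatten; apply: eq_map => e'.
by rewrite cat_rcons.
Qed.

Definition blocks_prog (bs : seq block) : program :=
  foldr (fun b P => Seq (nest_prog 2 b.1.1 b) P) Skip bs.

Lemma blocks_progP s bs : mem [:: 0; n] s ->
  {in bs, forall b, b.1.1.+2 <= M} ->
  exists s', does (blocks_prog bs) s s'
      (\sum_(b <- bs) nest_time b.1.1 b).+1
    /\ output s' = output s ++ flatten [seq block_out code b | b <- bs].
Proof.
elim: bs s => [|b bs IH] s He bM.
  by exists s; rewrite big_nil cats0; split=> //; exists 1 => //; apply: ESkip.
have [|||s1 [D1 He1 O1]] := @nest_progP b.1.1 [:: 0; n] s b _ _ _ He => //.
  by rewrite /= add2n bM ?mem_head.
have [|s2 [D2 O2]] := IH s1 He1; first by move=> c cb; apply: bM; rewrite inE cb orbT.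
exists s2; split; first by rewrite big_cons -addnS; apply: does_seq D1 D2.
by rewrite O2 O1 -catA.
Qed.

(** Register 4 stays 0 and register 5 counts the letters; these are the first two entries of the
    environment. *)
Definition init_prog : program :=
  Seq (Read 0) (While 0
    (Seq (Cst 1 (4 + M)) (Seq (Plus 1 1 5) (Seq (Store 1 0)
    (Seq (Cst 1 1) (Seq (Plus 5 5 1) (Read 0))))))).

(** As 0 is not a letter, the loop stops exactly at the end of the input. Each letter costs 7 steps;
    the first [Read] and the last test cost 2. *)
Lemma init_progP : 1 < M -> 0 \notin code ->
  exists2 s, does init_prog (State (fun=> 0) code [::]) s (7 * n + 2)
    & mem [:: 0; n] s /\ output s = [::].
Proof.
move=> M1 code0.
pose ok k s := [/\ regs s 0 = nth 0 code k, regs s 4 = 0, regs s 5 = k,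
  forall p, regs s (4 + M + p) = nth 0 (take k code) p &
  input s = drop k.+1 code /\ output s = [::]].
have loop m s : m <= n -> ok (n - m) s -> exists2 s', ok n s' & 
    does (While 0
    (Seq (Cst 1 (4 + M)) (Seq (Plus 1 1 5) (Seq (Store 1 0)
    (Seq (Cst 1 1) (Seq (Plus 5 5 1) (Read 0))))))) s s' (7 * m + 1).
  elim: m s => [|m IH] s mn okS.
    rewrite subn0 in okS; exists s => //; exists 1 => //.
    by apply: EWhileFalse; case: okS => ->; rewrite nth_default.
  set k := n - m.+1 in okS.
  have kn : k < n by rewrite /k; lia.
  case: okS => r0 r4 r5 rM [ri ro].
  pose s1 := set_reg s 1 (4 + M).
  pose s2 := set_reg s1 1 (4 + M + k).
  pose s3 := set_reg s2 (4 + M + k) (nth 0 code k).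
  pose s4 := set_reg s3 1 1.
  pose s5 := set_reg s4 5 k.+1.
  pose s6 := set_reg (State (regs s5) (behead (input s5)) (output s5)) 0
    (head 0 (input s5)).
  have [|s7 ok7 [t Et tT]] := IH s6 (ltnW mn).
    rewrite (_ : n - m = k.+1); last by rewrite /k; lia.
    have E6 j : regs s6 j = if j == 0 then nth 0 code k.+1 else
        if j == 5 then k.+1 else if j == 1 then 1 else
        if j == 4 + M + k then nth 0 code k else regs s j.
      rewrite /s6 /s5 /s4 /s3 /s2 /s1 !regs_set /=.
      by rewrite ri -nth0 nth_drop addn0; do 5!case: eqP => //.
    split; rewrite ?E6 //.
    - by rewrite !ifN //; lia.
    - move=> p; rewrite E6 rM (take_nth 0 kn) nth_rcons (size_takel (ltnW kn)).
      do 3!(case: eqP => [|_]; first lia).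
      rewrite eqn_add2l; case: ltngtP => // kp.
      by rewrite nth_default // (size_takel (ltnW kn)) ltnW.
    - by rewrite /= ri ro -drop1 drop_drop add1n.
  exists s7 => //; exists (6 + t).+1; last lia.
  apply: EWhileTrue Et; first 
    by rewrite r0 lt0n; apply: contraNneq code0 => <-; apply: mem_nth.
  rewrite -[6]/(1 + (1 + (1 + (1 + (1 + 1))))).
  apply: ESeq (ECst _ _ _) _; apply: ESeq (EPlus _ _ _ _) _.
  have -> : set_reg s1 1 (regs s1 1 + regs s1 5) = s2 by rewrite /s2 /s1 /= r5.
  apply: ESeq (EStore _ _ _) _.
  have -> : set_reg s2 (regs s2 1) (regs s2 0) = s3 by rewrite /s3 /= r0.
  apply: ESeq (ECst _ _ _) _; apply: ESeq (EPlus _ _ _ _) _.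
  have -> : set_reg s4 5 (regs s4 5 + regs s4 1) = s5.
    have E5 : (5 == 4 + M + k) = false by apply/negP => /eqP; lia.
    by rewrite /s5 /s4 /s3 /s2 /s1 !regs_set E5 /= r5 addn1.
  exact: ERead.
pose s0 := State (fun=> 0) code [::].
have [||s1 [r0 r4 r5 rM [ri ro]] [t Et tT]] :=
    loop n (set_reg (State (regs s0) (behead code) [::]) 0 (head 0 code)) => //.
  rewrite subnn; split; rewrite ?regs_set -?nth0 //.
    by move=> p; rewrite take0 nth_nil.
  by rewrite drop1.
exists s1; last first.
  split=> //; split=> // [j|p]; last by rewrite rM take_size.
  by case: j => [|[|j]] //= _; rewrite ?addn0 ?addn1.
exists (1 + t); last lia.
exact: ESeq (ERead _ s0) Et.
Qed.
End Templates.

(** The exponent is the greatest nesting depth of loops, but at least 1 because the input has to be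
    read. *)
Lemma blocks_run (bs : seq block) : exists P c, forall code, 0 \notin code ->
  exists2 t, runs P code (flatten [seq block_out code b | b <- bs]) t
    & t <= c * (size code).+1 ^ maxn 1 (\max_(b <- bs) b.1.1).
Proof.
(* The two extra registers hold the entries 0 and |w| of the environment. *)
set m := \max_(b <- bs) _; pose M := m.+2.
exists (Seq (init_prog M) (blocks_prog M bs)).
exists (10 + \sum_(b <- bs) (body_time b + 10 * m)) => code code0.
have [//|s [t Et tT] [He O]] := @init_progP M code _ code0.
have bm b : b \in bs -> b.1.1 <= m.
  by move=> bbs; apply: (leq_bigmax_seq (F := fun b : block => b.1.1)).
have [|s' [[t' Et' tT'] O']] := blocks_progP He (bs := bs).
  by move=> b /bm bM; rewrite /M !ltnS.
exists (t + t'); first by exists s'; [apply: ESeq Et Et' | rewrite O' O].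
set n := size code in tT tT' *; set k := maxn 1 m.
have n1 : n.+1 <= n.+1 ^ k by rewrite -{1}(expn1 n.+1) leq_pexp2l // leq_maxl.
have : \sum_(b <- bs) nest_time code b.1.1 b
       <= (\sum_(b <- bs) (body_time b + 10 * m)) * n.+1 ^ k.
  rewrite big_distrl big_seq [X in _ <= X]big_seq /=; apply: leq_sum => b /bm bM.
  rewrite leq_mul ?leq_add2l ?leq_mul2l ?bM //.
  by rewrite leq_pexp2l // (leq_trans bM) // leq_maxr.
move: n1 tT tT'; set S := \sum_(b <- bs) (_ + _).
move: (n.+1 ^ k) (\sum_(b <- bs) _) => x y; nia.
Qed.

(** * Trees as strings *)

Lemma tree_ind_mem (F : eqType) (P : tree F -> Prop) :
  (forall i, P (Var i)) ->
  (forall f ts, {in ts, forall t, P t} -> P (Node f ts)) ->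
  forall t, P t.
Proof.
move=> HV HN; fix IH 1 => -[i|f ts]; first exact: HV.
apply: HN; elim: ts => [|t ts IHts] t'; first discriminate.
rewrite inE => /predU1P[->|]; first exact: IH.
exact: IHts.
Qed.

Section TreeStrings.
Variable F : eqType.
Implicit Types (t : tree F).

Fixpoint tstr t : seq (F + nat) :=
  match t with
  | Var i => [:: inr i]
  | Node f ts => inl f :: flatten (map tstr ts)
  end.

Definition svars (s : seq (F + nat)) : seq nat :=
  pmap (fun c => if c is inr i then Some i else None) s.

Lemma svars_cat s s' : svars (s ++ s') = svars s ++ svars s'.
Proof. exact: pmap_cat. Qed.

Lemma svars_tstr t : svars (tstr t) = tvars t.
Proof.
elim/tree_ind_mem: t => //= f ts; elim: ts => //= t ts IH H.
rewrite -IH => [|t' t'ts]; last by apply: H; rewrite inE t'ts orbT.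
by rewrite svars_cat H ?mem_head.
Qed.

(** In prefix notation, first-order substitution is a homomorphism of strings; this is what lets a
    word automaton handle trees. *)
Lemma tstr_plug ss t : tstr (plug ss t) =
  flatten [seq if c is inr i then tstr (nth (Var i) ss i) else [:: c]
          | c <- tstr t].
Proof.
elim/tree_ind_mem: t => [i|f ts H] /=; first by rewrite cats0.
congr (_ :: _); elim: ts H => //= t ts IH H.
rewrite map_cat flatten_cat H ?mem_head // IH // => t' t'ts.
by apply: H; rewrite inE t'ts orbT.
Qed.

Lemma tvars_plug ss t :
  tvars (plug ss t) = flatten [seq tvars (nth (Var i) ss i) | i <- tvars t].
Proof.
rewrite -!svars_tstr tstr_plug; elim: (tstr t) => //= c s IH.
by rewrite svars_cat IH; case: c => //= i; rewrite svars_tstr.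
Qed.
End TreeStrings.

Lemma flatten_nth (T : Type) (U : Type) (x0 : nat -> T) (f : T -> seq U) ss :
  flatten [seq f (nth (x0 i) ss i) | i <- iota 0 (size ss)]
  = flatten (map f ss).
Proof.
congr flatten; case: ss => // x ss; rewrite -[X in _ = map f X](mkseq_nth x).
rewrite -map_comp; apply/eq_in_map => i; rewrite mem_iota => /andP[_ lt] /=.
by congr f; apply: set_nth_default.
Qed.

Lemma infix_flatten (T : eqType) (s : seq T) ss x :
  x \in ss -> infix s x -> infix s (flatten ss).
Proof.
elim: ss => //= y ss IH; rewrite inE => /predU1P[->|xss] sx.
  exact: infix_catr.
by apply: infix_catl; apply: IH.
Qed.

(** * Runs of the automaton that reads a given word *)

Inductive tok (Sg X : Type) : Type :=
  | Let of Sg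
  | Out of X
  | In of X.
Arguments Let {Sg X} _.
Arguments Out {Sg X} _.
Arguments In {Sg X} _.

Definition map_tok (Sg X Y : Type) (f : X -> Y) (k : tok Sg X) : tok Sg Y :=
  match k with Let a => Let a | Out x => Out (f x) | In x => In (f x) end.

(* States are positions in w. A token [Out x] checks that the current         *)
(* position is x, and [In x] jumps to x, so that [:: Out x; In y] stands for  *)
(* a gap from x to y.                                                         *)
Section Runs.
Variables (Sg : finType) (Delta : {set Sg}) (w : seq Sg).
Let n := size w.

(** Past the end of w, [nth] yields 0, which codes no letter, so that reading never leaves w. *)
Definition step (k : tok Sg nat) (p : nat) : option nat :=
  match k with
  | Let a => if a \in Delta then
      if nth 0 (enc_word w) p == enc_sym a then Some p.+1 else None
      else Some p
  | Out x => if p == x then Some p else None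
  | In x => if x <= n then Some x else None
  end.

Fixpoint run (s : seq (tok Sg nat)) (p : nat) : option nat :=
  if s is k :: s' then obind (run s') (step k p) else Some p.

Lemma run_cat s s' p : run (s ++ s') p = obind (run s') (run s p).
Proof. by elim: s p => //= k s IH p; case: (step k p). Qed.

Lemma run_catP s s' p q : run (s ++ s') p = Some q <->
  exists2 r, run s p = Some r & run s' r = Some q.
Proof.
rewrite run_cat; case: (run s p) => /= [r|]; last by split=> // -[].
by split=> [|[r' [->]]] //; exists r.
Qed.

Lemma run_consP k s p q : run (k :: s) p = Some q <->
  exists2 r, step k p = Some r & run s r = Some q.
Proof.
rewrite [run _ _]/(obind (run s) (step k p)).
case: (step k p) => /= [r|]; last by split=> // -[].
by split=> [|[r' [->]]] //; exists r.
Qed.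

Lemma run_out x s p q : run (Out x :: s) p = Some q <-> p = x /\ run s p = Some q.
Proof. by rewrite /=; case: eqP => /= ?; split=> // -[]. Qed.

Lemma run_in x s p q : run (In x :: s) p = Some q <-> x <= n /\ run s x = Some q.
Proof. by rewrite /=; case: ifP => /= ?; split=> // -[]. Qed.

Lemma step_le k p q : p <= n -> step k p = Some q -> q <= n.
Proof.
case: k => [a|x|x] /= pn.
- case: ifP => _; last by case=> <-.
  case: eqP => // Hp [<-]; case: (ltnP p n) => //= np; move: Hp.
  by rewrite nth_default // size_map.
- by case: eqP => // _ [<-].
by case: ifP => // xn [<-].
Qed.

Lemma run_le s p q : p <= n -> run s p = Some q -> q <= n.
Proof.
elim: s p => /= [p pn [<-] //|k s IH p pn].
by case E: (step k p) => [r|] //=; apply: IH; apply: step_le E.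
Qed.

Definition refines (s s' : seq (tok Sg nat)) : Prop :=
  forall p q, run s p = Some q -> run s' p = Some q.

Lemma refines_refl s : refines s s.
Proof. by []. Qed.

Lemma refines_cat s1 s2 s1' s2' :
  refines s1 s1' -> refines s2 s2' -> refines (s1 ++ s2) (s1' ++ s2').
Proof.
move=> H1 H2 p q /run_catP[r /H1 Hr /H2 Hq]; apply/run_catP.
by exists r.
Qed.

Lemma refines_flatten (T : eqType) (f g : T -> seq (tok Sg nat)) s :
  {in s, forall x, refines (f x) (g x)} ->
  refines (flatten (map f s)) (flatten (map g s)).
Proof.
elim: s => [_|x s IH H]; [exact: refines_refl|apply: refines_cat].
  by apply: H; rewrite mem_head.
by apply: IH => y ys; apply: H; rewrite inE ys orbT.
Qed.

End Runs.

(** * Gaps left for the arguments of a value *)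

Section Holes.
(* If b holds, the variables of a pattern of rank k > 0 are expected to be    *)
(* consecutive and in order, and constitute one hole, located at x_1;         *)
(* otherwise every variable is a hole.                                        *)
Variable b : bool.

Definition is_hole (i : nat) : bool := ~~ b || (i == 0).
Definition nholes (k : nat) : nat := if b then (0 < k) : nat else k.

Lemma is_hole_lt k h : is_hole h && (h < k) = (h < nholes k).
Proof. by rewrite /is_hole /nholes; case: b => //=; lia. Qed.

Variable Sg : finType.

Definition at_holes (X : Type) (x : nat -> seq (tok Sg X)) (i : nat) :=
  if is_hole i then x i else [::].

(* An annotation of a pattern gives, for both of its ends, and for both ends  *)
(* of its holes, a position: slot 0 is for the pattern and slot h.+1 is for   *)
(* hole h; false and true stand for left and right.                           *)
Definition gaps (X : Type) (al : bool -> nat -> X) : nat -> seq (tok Sg X) :=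
  at_holes (fun h => [:: Out (al false h.+1); In (al true h.+1)]).

Lemma at_holesE (X : Type) (x : nat -> seq (tok Sg X)) i :
  at_holes x i = if is_hole i then x i else [::].
Proof. by []. Qed.

Lemma gapsE (X : Type) (al : bool -> nat -> X) h : gaps al h =
  if is_hole h then [:: Out (al false h.+1); In (al true h.+1)] else [::].
Proof. by []. Qed.

Definition spell (F : Type) (X : Type) (g : nat -> seq (tok F X)) (c : F + nat) :=
  match c with inl a => [:: Let a] | inr i => g i end.

Definition glin (X : Type) (g : nat -> seq (tok Sg X)) (t : tree Sg) :=
  flatten (map (spell g) (tstr t)).

Lemma glin_node X (g : nat -> seq (tok Sg X)) a ts :
  glin g (Node a ts) = Let a :: flatten (map (glin g) ts).
Proof.
rewrite /glin /=; congr (_ :: _); elim: ts => //= t ts IH.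
by rewrite map_cat flatten_cat IH.
Qed.

Lemma glin_plug X (g : nat -> seq (tok Sg X)) ss t :
  glin g (plug ss t) = glin (fun i => glin g (nth (Var i) ss i)) t.
Proof.
rewrite /glin tstr_plug; elim: (tstr t) => //= c s IH.
by rewrite map_cat flatten_cat IH; case: c.
Qed.

Lemma mem_svars (s : seq (Sg + nat)) i : (i \in svars s) = (inr i \in s).
Proof. by elim: s => //= -[a|j] s IH /=; rewrite !inE IH. Qed.

Lemma eq_spell X (g g' : nat -> seq (tok Sg X)) s :
  {in svars s, g =1 g'} -> map (spell g) s = map (spell g') s.
Proof.
move=> H; apply/eq_in_map => -[a|i] //= si; apply: H.
by rewrite mem_svars.
Qed.

Lemma eq_glin X (g g' : nat -> seq (tok Sg X)) t :
  {in tvars t, g =1 g'} -> glin g t = glin g' t.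
Proof. by rewrite -svars_tstr => H; rewrite /glin (eq_spell H). Qed.

(** The invariant of all generated components (see [rule_values]). In the footed mode, being footed
    turns into a property of the prefix string: x_1 ... x_k is a block in it. *)
Definition is_value (k : nat) (t : tree Sg) : bool :=
  perm_eq (tvars t) (iota 0 k) &&
  (b ==> infix (map inr (iota 0 k)) (tstr t)).

(** Group h consists of the arguments that together fill hole h. *)
Definition groups (T : Type) (ts : seq T) : seq (seq T) :=
  if b then (if ts is [::] then [::] else [:: ts])
  else [seq [:: t] | t <- ts].

Lemma size_groups T (ts : seq T) : size (groups ts) = nholes (size ts).
Proof. by rewrite /groups /nholes; case: b; [case: ts | rewrite size_map]. Qed.

Lemma groups_map T U (f : T -> U) ts : groups (map f ts) = map (map f) (groups ts).
Proof.
rewrite /groups; case: b; first by case: ts.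
by rewrite -!map_comp.
Qed.

Lemma flatten_groups T (ts : seq T) : flatten (groups ts) = ts.
Proof.
by rewrite /groups; case: b; [case: ts => //= t ts; rewrite cats0 | apply: flatten_seq1].
Qed.

Lemma svars_inr (s : seq nat) : svars (map (@inr Sg nat) s) = s.
Proof. by elim: s => //= i s ->. Qed.

(* In a footed pattern the arguments are consecutive, and so can be read as a *)
(* single string.                                                             *)
Lemma glin_groups X (g : tree Sg -> seq (tok Sg X)) ss t :
  is_value (size ss) t ->
  glin (fun i => g (nth (Var i) ss i)) t
  = glin (at_holes (fun h => flatten (nth [::] (groups (map g ss)) h))) t.
Proof.
case/andP => pt; rewrite /groups /at_holes /is_hole; case: b => /= Hf; last first.
  apply: eq_glin => i; rewrite (perm_mem pt) mem_iota => /andP[_ lt].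
  rewrite (nth_map [::]) ?size_map // (nth_map (Var i)) //=.
  by rewrite cats0.
case: ss pt Hf => [|s ss] pt Hf.
  by apply: eq_glin => i; rewrite (perm_mem pt).
rewrite /glin; case/infixP: Hf => s1 [s2 def_t].
move: pt; rewrite -svars_tstr def_t !svars_cat svars_inr => pt.
(* The block already accounts for all variables, so the strings around it contain none. *)
have := perm_size pt; rewrite !size_cat !size_iota => sz.
move: sz; rewrite addnCA -[RHS]addn0 => /addnI/eqP.
rewrite addn_eq0 => /andP[/nilP v1 /nilP v2].
rewrite !map_cat !flatten_cat.
set g1 := (fun i => g _); set g2 := (fun i => if _ then _ else _).
rewrite (@eq_spell _ g1 g2 s1) ?v1 // (@eq_spell _ g1 g2 s2) ?v2 //.
congr (_ ++ (_ ++ _)); rewrite -!map_comp.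
rewrite (flatten_nth (fun i => Var i)) /=.
(* The hole at x_1 stands for the whole group; the later variables of the block contribute nothing,
   by induction from index 1. *)
have : 1 != 0 by [].
elim: (size ss) 1 => [|k IH] i i0 /=; first by rewrite cats0.
by case: i i0 => // i _; apply: IH.
Qed.
End Holes.

(** * Runs over right-hand sides and over substituted forests *)

Section Substitution.
Variables (Sg : finType) (Delta : {set Sg}) (w : seq Sg) (b : bool).
Let n := size w.
Local Notation run := (run Delta w).
Local Notation gaps := (@gaps b Sg _).
Local Notation at_holes := (at_holes b).

Definition spans (al : bool -> nat -> nat) (t : tree Sg) : Prop :=
  run (glin (gaps al) t) (al false 0) = Some (al true 0).

(** The annotation records where the run enters and leaves each hole; as no variable is repeated,
    the records do not clash. *)
Lemma run_gaps (x : nat -> seq (tok Sg nat)) (s : seq (Sg + nat)) p q :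
  p <= n -> uniq (svars s) ->
  run (flatten (map (spell (at_holes x)) s)) p = Some q ->
  exists al : bool -> nat -> nat, [/\ forall sd h, al sd h <= n,
    run (flatten (map (spell (gaps al)) s)) p = Some q
    & {in svars s, forall h, is_hole b h ->
        run (x h) (al false h.+1) = Some (al true h.+1)}].
Proof.
elim: s p => [|c s IH] p pn; first by exists (fun _ _ => 0).
case: c => [a us|i /= /andP[iNs us]].
  case/run_consP=> r Hs Hr.
  have [al [al_n Hal Hx]] := IH r (step_le pn Hs) us Hr.
  exists al; split=> //.
  by apply/run_consP; exists r.
case hi: (is_hole b i); last first.
  rewrite at_holesE hi => Hr.
  have [al [al_n Hal Hx]] := IH p pn us Hr.
  exists al; split=> //; first by rewrite gapsE hi.
  by move=> h; rewrite inE => /predU1P[->|]; [rewrite hi | apply: Hx].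
rewrite at_holesE hi => /run_catP[r Hi Hr].
have rn := run_le pn Hi.
have [al [al_n Hal Hx]] := IH r rn us Hr.
pose al' sd h := if h == i.+1 then (if sd then r else p) else al sd h.
exists al'; split.
- by move=> [] h; rewrite /al'; case: eqP.
- rewrite gapsE hi /al' eqxx /= eqxx /= rn /= -Hal.
  congr (run (flatten _) _); apply: eq_spell => h hs.
  rewrite !(gapsE, at_holesE) /al' eqSS.
  by case: eqP => // hi'; rewrite -hi' hs in iNs.
move=> h; rewrite inE => /predU1P[-> _|hs hh]; first by rewrite /al' eqxx.
rewrite /al' eqSS; case: eqP => [hi'|_]; last exact: Hx.
by rewrite -hi' hs in iNs.
Qed.

Section Nonterminals.
Variable NT : eqType.

Definition seg (X : Type) (al : bool -> nat -> X) h (s : seq (tok Sg X)) :=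
  In (al false h) :: s ++ [:: Out (al true h)].

Definition segs (X : Type) (al : bool -> nat -> X) (ss : seq (seq (tok Sg X))) :=
  flatten [seq seg al h.+1 (nth [::] ss h) | h <- iota 0 (size ss)].

(* The string of a right-hand side, in which an argument of a nonterminal C   *)
(* is read as the piece that fills a gap of C, rather than in its place.      *)
Fixpoint lin (X : Type) (be : NT -> bool -> nat -> X)
    (g : nat -> seq (tok Sg X)) (t : tree (NT + Sg)) : seq (tok Sg X) :=
  match t with
  | Var i => g i
  | Node (inl C) ts => Out (be C false 0)
      :: segs (be C) (map flatten (groups b (map (lin be g) ts)))
      ++ [:: In (be C true 0)]
  | Node (inr a) ts => Let a :: flatten (map (lin be g) ts)
  end.

Lemma ntocc_cons (t : tree (NT + Sg)) u : ntocc (t :: u) = ntocc [:: t] ++ ntocc u.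
Proof. by rewrite /ntocc /flabels /= cats0 pmap_cat. Qed.

Lemma ntocc_cat (u u' : seq (tree (NT + Sg))) : ntocc (u ++ u') = ntocc u ++ ntocc u'.
Proof. by rewrite /ntocc /flabels map_cat flatten_cat pmap_cat. Qed.

Lemma ntocc_nt C (ts : seq (tree (NT + Sg))) :
  ntocc [:: Node (inl C) ts] = C :: ntocc ts.
Proof. by rewrite /ntocc /flabels /= cats0. Qed.

Lemma ntocc_t a (ts : seq (tree (NT + Sg))) :
  ntocc [:: Node (inr a) ts] = ntocc ts.
Proof. by rewrite /ntocc /flabels /= cats0. Qed.

Lemma ntocc_flatten (us : seq (seq (tree (NT + Sg)))) :
  ntocc (flatten us) = flatten (map (@ntocc NT Sg) us).
Proof. by elim: us => //= u us IH; rewrite ntocc_cat IH. Qed.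

Lemma ntocc_map1 (u : seq (tree (NT + Sg))) :
  ntocc u = flatten [seq ntocc [:: t] | t <- u].
Proof. by elim: u => //= t u IH; rewrite ntocc_cons IH. Qed.

Lemma mem_ntocc t (u : seq (tree (NT + Sg))) :
  t \in u -> {subset ntocc [:: t] <= ntocc u}.
Proof.
move=> tu C Ct; rewrite ntocc_map1; apply/flatten_mapP; by exists t.
Qed.

Lemma eq_lin X (be be' : NT -> bool -> nat -> X) g t :
  {in ntocc [:: t], be =1 be'} -> lin be g t = lin be' g t.
Proof.
elim/tree_ind_mem: t => // -[C|a] ts IH H /=.
  rewrite ntocc_nt in H; rewrite H ?mem_head //.
  have -> // : map (lin be g) ts = map (lin be' g) ts.
  apply/eq_in_map => t tts; apply: IH => // D Dt.
  by apply: H; rewrite inE (mem_ntocc tts) ?orbT.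
rewrite ntocc_t in H; congr (_ :: flatten _).
by apply/eq_in_map => t tts; apply: IH => // D /(mem_ntocc tts) /H.
Qed.

Lemma run_flatten_mem (T : eqType) (f : T -> seq (tok Sg nat)) s p q x :
  run (flatten (map f s)) p = Some q -> x \in s ->
  exists p' q', run (f x) p' = Some q'.
Proof.
elim: s p => // y s IH p /run_catP[r Hy Hr]; rewrite inE => /predU1P[->|xs].
  by exists p, r.
exact: IH Hr xs.
Qed.

Lemma run_flatten_ex (T : eqType) (f : T -> seq (tok Sg nat)) s p :
  {in s, forall x p, exists q, run (f x) p = Some q} ->
  exists q, run (flatten (map f s)) p = Some q.
Proof.
elim: s p => [|x s IH] p H; first by exists p.
have [r Hr] := H x (mem_head _ _) p.
have [y ys|q Hq] := IH r; first by apply: H; rewrite inE ys orbT.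
by exists q; apply/run_catP; exists r.
Qed.

Lemma run_seg al h s p q : run (seg al h s) p = Some q <->
  [/\ al false h <= n, run s (al false h) = Some (al true h) & q = al true h].
Proof.
rewrite /seg run_in run_cat; split=> [[-> /=]|[-> -> ->] /=]; last by rewrite eqxx.
by case: (run s _) => //= r; case: eqP => //= -> [->].
Qed.

Lemma run_segs (al : bool -> nat -> nat) ss p q :
  run (segs al ss) p = Some q ->
  forall h, h < size ss ->
    run (nth [::] ss h) (al false h.+1) = Some (al true h.+1).
Proof.
move=> /run_flatten_mem H h hs; have [|p' [q' /run_seg[]]] // := H h.
by rewrite mem_iota.
Qed.

Lemma run_segs_ex (al : bool -> nat -> nat) ss p :
  (forall h, h < size ss -> al false h.+1 <= n /\
    run (nth [::] ss h) (al false h.+1) = Some (al true h.+1)) ->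
  exists q, run (segs al ss) p = Some q.
Proof.
move=> H; apply: run_flatten_ex => h; rewrite mem_iota => /= /H[H1 H2] p'.
by exists (al true h.+1); apply/run_seg.
Qed.

Variables (rk : Sg -> nat) (G : mcftg NT Sg) (sigma : seq NT) (v : seq (tree Sg)).

Local Notation vv C := (nth (Var 0) v (index C sigma)).
Local Notation sub := (subst sigma v).

Lemma glin_subst_nt X (g : nat -> seq (tok Sg X)) C ts :
  is_value b (size ts) (vv C) ->
  glin g (sub (Node (inl C) ts)) =
  glin (at_holes (fun h => nth [::]
     (map flatten (groups b (map (glin g \o sub) ts))) h)) (vv C).
Proof.
move=> HC /=; rewrite glin_plug (@glin_groups b) ?size_map // -map_comp.
apply: eq_glin => i it; rewrite !at_holesE; case: ifP => // hi.
rewrite (nth_map [::]) // size_groups size_map -is_hole_lt hi /=.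
by move: it; case/andP: HC => /perm_mem ->; rewrite mem_iota.
Qed.

(** A run over the right-hand side reads each group of arguments of C from one end of its gap to the
    other. Put back into the gaps of the run over the value of C, these pieces give a run over the
    substituted tree. *)
Lemma lin_subst (be : NT -> bool -> nat -> nat) g t :
  ranked (symrk rk G) t ->
  {in ntocc [:: t], forall C, is_value b (ntrk G C) (vv C) /\ spans (be C) (vv C)} ->
  refines Delta w (lin be g t) (glin g (sub t)).
Proof.
elim/tree_ind_mem: t => [i|[C|a] ts IH] /=.
- by move=> _ _; rewrite /glin /= cats0; apply: refines_refl.
- case/andP=> /eqP sz rts; rewrite ntocc_nt => H.
  have [HC sC] := H C (mem_head _ _).
  move=> p q /run_out[-> /run_catP[r Hr /run_in[rn [<-]]]].
  rewrite -[plug _ _]/(sub (Node (inl C) ts)) glin_subst_nt ?sz //.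
  move: sC; rewrite /spans /glin.
  apply: (@refines_flatten _ _ _ _ (spell _) (spell _)) => -[i|i] ti /=.
    exact: refines_refl.
  rewrite !(gapsE, at_holesE); case: ifP => hi; last exact: refines_refl.
  have ih : i < size (groups b ts).
    rewrite size_groups -is_hole_lt hi sz; case/andP: HC => pC _.
    by rewrite -mem_svars svars_tstr (perm_mem pC) mem_iota in ti.
  have := run_segs Hr; rewrite size_map => /(_ i); rewrite size_groups size_map.
  rewrite -size_groups => /(_ ih).
  rewrite !groups_map -!map_comp !(nth_map [::]) //= => Hi.
  move=> p' q' /run_out[-> /run_in[_ [<-]]]; move: Hi.
  apply: refines_flatten => t ti'; have tts : t \in ts.
    rewrite -(flatten_groups b ts); apply/flattenP.
    by exists (nth [::] (groups b ts) i); first exact: mem_nth.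
  apply: IH => //; first by have /allP := rts; apply.
  by move=> D Dt; apply: H; rewrite inE (mem_ntocc tts) ?orbT.
case/andP=> _ rts; rewrite ntocc_t => H.
rewrite glin_node; apply: (@refines_cat _ _ _ [:: Let a] _ [:: Let a]) => //.
rewrite -map_comp; apply: refines_flatten => t tts; apply: IH => //.
  by have /allP := rts; apply.
by move=> C Ct; apply: H; apply: mem_ntocc tts _ Ct.
Qed.

Lemma uniq_flatten (T : eqType) (ss : seq (seq T)) s :
  uniq (flatten ss) -> s \in ss -> uniq s.
Proof.
elim: ss => //= s' ss IH; rewrite cat_uniq => /and3P[us _ uss].
by rewrite inE => /predU1P[->|] //; apply: IH.
Qed.

Definition bounded (be : NT -> bool -> nat -> nat) : Prop :=
  forall C sd h, be C sd h <= n.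

(** Annotations found separately for parts without common nonterminals are glued; this is how unique
    labeling of right-hand sides enters. *)
Lemma merge_annotations (T : eqType) (occ : T -> seq NT)
    (Q : T -> (NT -> bool -> nat -> nat) -> Prop) (s : seq T) :
  (forall x be be', {in occ x, be =1 be'} -> Q x be -> Q x be') ->
  uniq (flatten (map occ s)) ->
  {in s, forall x, exists2 be, bounded be & Q x be} ->
  exists2 be, bounded be & {in s, forall x, Q x be}.
Proof.
move=> eqQ; elim: s => [|x s IH] /=; first by exists (fun _ _ _ => 0).
rewrite cat_uniq => /and3P[_ xs us] H.
have [be nbe Hbe] := H x (mem_head _ _).
have [|be' nbe' Hbe'] := IH us; first by move=> y ys; apply: H; rewrite inE ys orbT.
exists (fun C => if C \in occ x then be C else be' C).
  by move=> C sd h; case: ifP.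
move=> y; rewrite inE => /predU1P[->|ys].
  by apply: eqQ Hbe => C ->.
apply: eqQ (Hbe' y ys) => C Cy; rewrite ifN //.
by apply: contra xs => Cx; apply/hasP; exists C => //; apply/flatten_mapP; exists y.
Qed.

Definition derived (be : NT -> bool -> nat -> nat) g u p q : Prop :=
  run (flatten (map (lin be g) u)) p = Some q /\
  {in ntocc u, forall C, spans (be C) (vv C)}.

Lemma eq_derived be be' g u p q :
  {in ntocc u, be =1 be'} -> derived be g u p q -> derived be' g u p q.
Proof.
move=> E [Hr Hs]; split=> [|C Cu]; last by rewrite -E //; apply: Hs.
rewrite -Hr; congr (run (flatten _) _); apply/eq_in_map => t tu.
by apply: eq_lin => C Ct; rewrite E //; apply: mem_ntocc Ct.
Qed.

(** Converse of [lin_subst]: the positions that a given run passes at the ends of nonterminals and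
    arguments serve as the annotation. *)
Lemma lin_ex g u p q :
  all (ranked (symrk rk G)) u -> uniq (ntocc u) ->
  {in ntocc u, forall C, is_value b (ntrk G C) (vv C)} ->
  p <= n -> run (flatten (map (glin g \o sub) u)) p = Some q ->
  exists2 be, bounded be & derived be g u p q.
Proof.
pose P u := forall p q, all (ranked (symrk rk G)) u -> uniq (ntocc u) ->
  {in ntocc u, forall C, is_value b (ntrk G C) (vv C)} ->
  p <= n -> run (flatten (map (glin g \o sub) u)) p = Some q ->
  exists2 be, bounded be & derived be g u p q.
suff H : P u by apply: H.
(* A forest reduces to its trees by cutting the run between them and merging the two annotations. *)
have Pseq us : {in us, forall t, P [:: t]} -> P us.
  elim: us => [|t us IH] H p' q'.
    by move=> _ _ _ _ Hr; exists (fun _ _ _ => 0).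
  rewrite /= ntocc_cons cat_uniq => /andP[rt rus] /and3P[ut tus uus] Hv pn.
  case/run_catP=> r Ht Hus.
  have rn := run_le pn Ht.
  have [||C Ct|||be nbe Hbe] := H t (mem_head _ _) p' r => //.
  - by rewrite /= rt.
  - by apply: Hv; rewrite mem_cat Ct.
  - by rewrite /= cats0.
  have [||||||be' nbe' Hbe'] := IH _ r q' => //.
  - by move=> t' t'us; apply: H; rewrite inE t'us orbT.
  - by move=> C Cus; apply: Hv; rewrite mem_cat Cus orbT.
  pose be2 C := if C \in ntocc [:: t] then be C else be' C.
  exists be2; first by move=> C sd h; rewrite /be2; case: ifP.
  have {Hbe} [Ht1 Ht2] : derived be2 g [:: t] p' r.
    by apply: eq_derived Hbe => C; rewrite /be2 => ->.
  have {Hbe'} [Hus1 Hus2] : derived be2 g us r q'.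
    apply: eq_derived Hbe' => C Cus; rewrite /be2 ifN //.
    by apply: contra tus => Ct; apply/hasP; exists C.
  split=> [|C]; first by apply/run_catP; exists r; rewrite /= ?cats0 in Ht1 *.
  by rewrite ntocc_cons mem_cat => /orP[/Ht2|/Hus2].
apply: (Pseq) => t _; elim/tree_ind_mem: t => [i|[C|a] ts IH] p' q'.
- rewrite /glin /= !cats0 => _ _ _ _ Hr; exists (fun _ _ _ => 0) => //.
  by split=> //=; rewrite cats0.
- rewrite [map _ _]/= [flatten _]cats0 [all _ _]/= andbT ntocc_nt.
  case/andP=> /eqP sz rts /= /andP[Cts uts] Hv pn.
  have HC := Hv C (mem_head _ _).
  rewrite -[plug _ _]/(sub (Node (inl C) ts)) glin_subst_nt ?sz //.
  have pC : perm_eq (tvars (vv C)) (iota 0 (ntrk G C)) by case/andP: HC.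
  have uC : uniq (svars (tstr (vv C))).
    by rewrite svars_tstr (perm_uniq pC) iota_uniq.
  (* The run over the value of C, with its arguments in place, yields the slots of C that belong to
     holes. *)
  case/(run_gaps pn uC) => al [nal Hal Hx].
  have [||h|be nbe Hbe] := @merge_annotations _ 
      (fun h => ntocc (nth [::] (groups b ts) h))
      (fun h be => derived be g (nth [::] (groups b ts) h)
                     (al false h.+1) (al true h.+1))
      (iota 0 (size (groups b ts))).
  + by move=> h be be'; apply: eq_derived.
  + rewrite (_ : flatten _ = ntocc ts) //.
    rewrite -[in RHS](flatten_groups b ts) ntocc_flatten.
    exact: (flatten_nth (fun _ => [::])).
  + rewrite mem_iota => /= hs; set gu := nth _ _ h.
    have uts' : {subset gu <= ts}.
      move=> t tu; rewrite -(flatten_groups b ts); apply/flattenP.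
      by exists gu => //; apply: mem_nth.
    have sub_u : {subset ntocc gu <= ntocc ts}.
      move=> D; rewrite ntocc_map1 => /flatten_mapP[t /uts' tts].
      exact: mem_ntocc.
    apply: (Pseq) => [t /uts' tts|||||].
    * exact: IH.
    * by apply/allP => t /uts'; apply: (allP rts).
    * move: uts; rewrite -(flatten_groups b ts) ntocc_flatten.
      by move/uniq_flatten; apply; apply/map_f/mem_nth.
    * by move=> D /sub_u Dts; apply: Hv; rewrite inE Dts orbT.
    * exact: nal.
    * have hC : is_hole b h && (h < ntrk G C).
        by rewrite is_hole_lt -sz -size_groups.
    case/andP: hC => hh hC; have := Hx h; rewrite svars_tstr (perm_mem pC).
    rewrite mem_iota hC => /(_ isT hh).
    rewrite groups_map -map_comp (nth_map [::]) //.
  (* Slot 0 of C receives the two ends of the whole run. Since C does not occur in its own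
     arguments, their annotations are unaffected. *)
  pose be2 D := if D == C then
    fun sd h => if h is h'.+1 then al sd h else if sd then q' else p'
    else be D.
  have {}Hbe h : h < size (groups b ts) -> derived be2 g (nth [::] (groups b ts) h)
                     (al false h.+1) (al true h.+1).
    move=> hs; have := Hbe h; rewrite mem_iota => /(_ hs).
    apply: eq_derived => D Du; rewrite /be2 ifN //.
    apply: contraNneq Cts => <-; move: Du; rewrite ntocc_map1.
    case/flatten_mapP=> t tu; apply: mem_ntocc.
    rewrite -(flatten_groups b ts); apply/flattenP.
    by exists (nth [::] (groups b ts) h) => //; apply: mem_nth.
  have qn := run_le pn Hal.
  exists be2.
    move=> D sd h; rewrite /be2; case: eqP => // _; case: h => [|h] //.
    by case: sd.
  split.
    rewrite [map _ _]/= [flatten _]cats0; apply/run_out.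
    rewrite {1}/be2 eqxx; split=> //.
    rewrite groups_map -map_comp.
    have [|r Hr] := @run_segs_ex (be2 C)
        [seq (flatten \o [eta map (lin be2 g)]) i | i <- groups b ts] p'.
      rewrite size_map => h hs; rewrite (nth_map [::]) // /be2 eqxx nal; split=> //.
      by have [] := Hbe h hs.
    apply/run_catP; exists r => //.
    by rewrite /be2 eqxx /= qn.
  rewrite ntocc_nt => D; rewrite inE => /predU1P[->|].
    rewrite /be2 eqxx /spans -Hal /glin; congr (run (flatten _) _).
  rewrite -(flatten_groups b ts) ntocc_flatten => /flatten_mapP[g1 g1g Dg1].
  have := Hbe (index g1 (groups b ts)); rewrite index_mem nth_index // => H.
  by have [_] := H g1g; apply.
rewrite ntocc_t => /andP[/andP[_ rts] _] uts Hv pn.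
rewrite [map _ _]/= [flatten _]cats0 -[glin _ _]/(glin g (Node a (map sub ts))).
rewrite glin_node => /run_consP[r Hr]; rewrite -map_comp => Hts.
have [||be nbe [Hbe Hs]] := Pseq ts _ r q' rts uts Hv _ Hts.
- exact: IH.
- exact: step_le Hr.
exists be => //; split; last by rewrite ntocc_t.
by rewrite [map _ _]/= [flatten _]cats0; apply/run_consP; exists r.
Qed.

Lemma perm_tvars_subst t : ranked (symrk rk G) t ->
  {in ntocc [:: t], forall C, is_value b (ntrk G C) (vv C)} ->
  perm_eq (tvars (sub t)) (tvars t).
Proof.
elim/tree_ind_mem: t => [i|f ts IH] //= /andP[/eqP sz rts] Hv.
have {}IH : perm_eq (flatten (map (@tvars _) (map sub ts)))
                    (flatten (map (@tvars _) ts)).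
  have Hts : {in ntocc ts, forall C, is_value b (ntrk G C) (vv C)}.
    by case: f sz Hv => [C|a] _; rewrite ?ntocc_nt ?ntocc_t => Hv C' C's;
      apply: Hv; rewrite ?inE C's ?orbT.
  elim: ts rts Hts IH {sz Hv} => //= t ts IHts /andP[rt rts].
  rewrite ntocc_cons => Hts IH; apply: perm_cat.
    by apply: IH; rewrite ?mem_head // => C Ct; apply: Hts; rewrite mem_cat Ct.
  apply: IHts => // [C Cts|t' t's]; first by apply: Hts; rewrite mem_cat Cts orbT.
  by apply: IH; rewrite inE t's orbT.
case: f sz Hv => [C|a] //= sz; rewrite ntocc_nt => /(_ C (mem_head _ _)).
case/andP=> pC _; apply: perm_trans IH.
rewrite tvars_plug -(flatten_nth (fun i => Var i)).
by apply: perm_flatten; apply: perm_map; rewrite size_map sz.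
Qed.

(** If the foot is the root, its children are x_1, ..., x_k, and the block comes from the value of
    C, or from the children of a terminal. A foot further down lies in one argument, whose string is
    inserted as a whole. *)
Lemma infix_tstr_subst k t : b -> ranked (symrk rk G) t ->
  {in ntocc [:: t], forall C, is_value b (ntrk G C) (vv C)} ->
  has_foot (symrk rk G) k t -> infix (map inr (iota 0 k)) (tstr (sub t)).
Proof.
move=> hb; elim/tree_ind_mem: t => // f ts IH /= /andP[/eqP sz rts] Hv.
have Hts : {in ntocc ts, forall C, is_value b (ntrk G C) (vv C)}.
  by case: f sz Hv => [C|a] _; rewrite ?ntocc_nt ?ntocc_t => Hv C' C's;
    apply: Hv; rewrite ?inE C's ?orbT.
have HC C : f = inl C -> is_value b (ntrk G C) (vv C).
  by move=> fC; apply: Hv; rewrite fC ntocc_nt mem_head.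
have plugE C : f = inl C -> tstr (plug (map sub ts) (vv C)) =
    flatten [seq if c is inr i then tstr (nth (Var i) (map sub ts) i) else [:: c]
          | c <- tstr (vv C)] by move=> _; apply: tstr_plug.
case/orP=> [/andP[/eqP fk /eqP tsE]|/hasP[t tts ft]].
  have subE : map sub ts = map Var (iota 0 k) by rewrite tsE -map_comp.
  have strE : flatten (map (@tstr _) (map sub ts)) = map inr (iota 0 k).
    by rewrite subE -map_comp; elim: (iota 0 k) => //= i s ->.
  case: f fk HC plugE {sz Hv} => [C|a] fk HC plugE; last first.
    rewrite -[tstr _]/(inl a :: flatten (map (@tstr _) (map sub ts))) strE -cat1s.
    exact/infix_catl/infix_refl.
  rewrite plugE // subE.
  case/andP: (HC C erefl) => pC /implyP/(_ hb).
  move: pC; rewrite (_ : ntrk G C = k) // => pC.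
  rewrite (_ : flatten _ = tstr (vv C)) //.
  rewrite -[RHS]flatten_seq1; congr flatten; apply/eq_in_map => -[a|i] // ic.
  have : i \in tvars (vv C) by rewrite -svars_tstr mem_svars.
  rewrite (perm_mem pC) mem_iota => /= ik.
  by rewrite (nth_map 0) ?size_iota // nth_iota.
have {IH} Ht : infix (map inr (iota 0 k)) (tstr (sub t)).
  apply: IH => //; first exact: (allP rts).
  by move=> C Ct; apply: Hts; apply: mem_ntocc tts _ Ct.
case: f sz HC plugE {Hv} => [C|a] sz HC plugE; last first.
  rewrite -[tstr _]/([:: inl a] ++ flatten (map (@tstr _) (map sub ts))).
  apply: infix_catl; apply: infix_flatten Ht.
  by apply/map_f/map_f.
rewrite plugE //; apply: infix_flatten Ht.
have it : index t ts < size ts by rewrite index_mem.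
apply/mapP; exists (inr (index t ts)); last first.
  by rewrite (nth_map t) // nth_index.
rewrite -mem_svars svars_tstr; case/andP: (HC C erefl) => pC _.
by rewrite (perm_mem pC) mem_iota /= -[ntrk G C]sz.
Qed.

Lemma subst_value t : pattern (symrk rk G) t ->
  (b -> footed_pattern (symrk rk G) t) ->
  {in ntocc [:: t], forall C, is_value b (ntrk G C) (vv C)} ->
  is_value b (prank t) (sub t).
Proof.
case/andP=> rt pt ft Hv; apply/andP; split.
  exact: perm_trans (perm_tvars_subst rt Hv) pt.
apply/implyP => hb; case/orP: (ft hb) => [/eqP->|]; first exact: infix0s.
exact: infix_tstr_subst.
Qed.

(** Each segment opens with a jump, so the components can be chained and a single run checks the
    whole rule. *)
Definition rule_toks X (al be : NT -> bool -> nat -> X) A u :=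
  flatten [seq seg (al x.1) 0 (lin be (gaps (al x.1)) x.2) | x <- zip A u].

Definition spansb (al : NT -> bool -> nat -> nat) C (t : tree Sg) : bool :=
  run (glin (gaps (al C)) t) (al C false 0) == Some (al C true 0).

Lemma spansP al C t : reflect (spans (al C) t) (spansb al C t).
Proof. exact: eqP. Qed.

Lemma zip_mapr (S T U : Type) (f : T -> U) (s : seq S) (u : seq T) :
  zip s (map f u) = [seq (x.1, f x.2) | x <- zip s u].
Proof. by elim: s u => [|x s IH] [|t u] //=; rewrite IH. Qed.

Lemma rule_toks_sound al be A u q p :
  size A = size u -> all (ranked (symrk rk G)) u ->
  {in ntocc u, forall C, is_value b (ntrk G C) (vv C) /\ spans (be C) (vv C)} ->
  run (rule_toks al be A u) p = Some q ->
  all2 (spansb al) A (map sub u).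
Proof.
move=> szA ru Hv /run_flatten_mem H.
rewrite all2E size_map szA eqxx; apply/allP => -[C t].
rewrite zip_mapr => /mapP[x xz [-> ->]] /=; apply/spansP.
have xu : x.2 \in u by rewrite -(unzip2_zip (eq_leq (esym szA))) map_f.
have [p' [q' /run_seg[_ Hr _]]] := H x xz.
apply: lin_subst Hr; first exact: (allP ru).
by move=> D Dx; apply: Hv; apply: mem_ntocc xu _ Dx.
Qed.

Lemma rule_toks_complete al A u p :
  bounded al -> size A = size u -> all (ranked (symrk rk G)) u ->
  uniq (ntocc u) ->
  {in ntocc u, forall C, is_value b (ntrk G C) (vv C)} ->
  all2 (spansb al) A (map sub u) ->
  exists2 be, bounded be & (exists q, run (rule_toks al be A u) p = Some q)
    /\ {in ntocc u, forall C, spans (be C) (vv C)}.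
Proof.
move=> nal szA ru uu Hv; rewrite all2E => /andP[_ /allP H].
have xu x : x \in zip A u -> x.2 \in u.
  by move=> xz; rewrite -(unzip2_zip (eq_leq (esym szA))) map_f.
have [||x xz|be nbe Hbe] := @merge_annotations _ (fun x => ntocc [:: x.2])
  (fun x be => derived be (gaps (al x.1)) [:: x.2] (al x.1 false 0) (al x.1 true 0))
  (zip A u).
- by move=> x be be'; apply: eq_derived.
- move: uu; rewrite ntocc_map1 -{1}(unzip2_zip (eq_leq (esym szA))).
  by rewrite /unzip2 -map_comp.
- apply: lin_ex => //.
  + by rewrite /= (allP ru) ?xu.
  + apply: uniq_flatten (map_f (fun t => ntocc [:: t]) (xu x xz)).
    by rewrite -ntocc_map1.
  + by move=> C Cx; apply: Hv; apply: mem_ntocc (xu x xz) _ Cx.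
  rewrite [map _ _]/= [flatten _]cats0; apply/spansP.
  apply: (H (x.1, sub x.2)); rewrite zip_mapr.
  exact: (map_f (fun x => (x.1, sub x.2))).
exists be => //; split.
  apply: run_flatten_ex => x /Hbe[Hr _] p'; exists (al x.1 true 0).
  by apply/run_seg; move: Hr; rewrite /= cats0.
move=> C; rewrite ntocc_map1 => /flatten_mapP[t tu Ct].
move: tu; rewrite -(unzip2_zip (eq_leq (esym szA))) => /mapP[x xz tx].
by have [_] := Hbe x xz; apply; rewrite -tx.
Qed.

End Nonterminals.
End Substitution.

(** * Rule instances *)

Section TokenPlaces.
Variables (Sg : finType) (X : eqType).
Implicit Types (s : seq (tok Sg X)).

Definition ins s : seq X := pmap (fun k => if k is In x then Some x else None) s.
Definition outs s : seq X := pmap (fun k => if k is Out x then Some x else None) s.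

Lemma ins_cat s s' : ins (s ++ s') = ins s ++ ins s'.
Proof. exact: pmap_cat. Qed.

Lemma outs_cat s s' : outs (s ++ s') = outs s ++ outs s'.
Proof. exact: pmap_cat. Qed.

Lemma mem_ins_flatten (T : eqType) (f : T -> seq (tok Sg X)) (u : seq T) x :
  x \in ins (flatten (map f u)) -> exists2 t, t \in u & x \in ins (f t).
Proof.
elim: u => //= t u IH; rewrite ins_cat mem_cat => /orP[xt|/IH[t' t'u xt']].
  by exists t; rewrite ?mem_head.
by exists t'; rewrite // inE t'u orbT.
Qed.

Lemma mem_outs_flatten (T : eqType) (f : T -> seq (tok Sg X)) (u : seq T) t :
  t \in u -> {subset outs (f t) <= outs (flatten (map f u))}.
Proof.
elim: u => //= t' u IH; rewrite inE outs_cat => /predU1P[->|/IH tu] x xt.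
  by rewrite mem_cat xt.
by rewrite mem_cat tu ?orbT.
Qed.

Lemma ins_seg al h s : ins (seg al h s) = al false h :: ins s.
Proof. by rewrite /seg /= ins_cat /= cats0. Qed.

Lemma outs_seg al h s : outs (seg al h s) = rcons (outs s) (al true h).
Proof. by rewrite /seg /= outs_cat cats1. Qed.

Lemma ins_gaps b (al : bool -> nat -> X) k i x : i < k ->
  x \in ins (gaps b Sg al i) -> exists2 h, h < nholes b k & x = al true h.+1.
Proof.
move=> ik; rewrite /gaps /at_holes; case: ifP => // hi; rewrite inE => /eqP->.
by exists i; rewrite // -is_hole_lt hi.
Qed.

Lemma outs_gaps b (al : bool -> nat -> X) k h : h < nholes b k ->
  h < k /\ al false h.+1 \in outs (gaps b Sg al h).
Proof.
rewrite -is_hole_lt => /andP[hh hk]; split=> //.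
by rewrite /gaps /at_holes hh inE eqxx.
Qed.
End TokenPlaces.

Lemma all2_cat (S T : Type) (p : S -> T -> bool) A A' v v' : size A = size v ->
  all2 p (A ++ A') (v ++ v') = all2 p A v && all2 p A' v'.
Proof.
by elim: A v => [|x A IH] [|y v] //= [/IH->]; rewrite andbA.
Qed.

Lemma all2_flatten (S T : Type) (p q : S -> T -> bool) As vs :
  all2 (all2 q) As vs -> all2 p (flatten As) (flatten vs) = all2 (all2 p) As vs.
Proof.
elim: As vs => [|A As IH] [|v vs] //= /andP[]; rewrite all2E => /andP[/eqP sz _].
by move/IH=> {}IH; rewrite all2_cat // IH.
Qed.

Lemma size_all2_flatten (S T : Type) (q : S -> T -> bool) As vs :
  all2 (all2 q) As vs -> size (flatten As) = size (flatten vs).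
Proof.
elim: As vs => [|A As IH] [|v vs] //= /andP[]; rewrite all2E => /andP[/eqP sz _].
by rewrite !size_cat sz => /IH->.
Qed.

Lemma all2_nth (S : eqType) (T : Type) (p : S -> T -> bool) A v x t0 :
  all2 p A v -> x \in A -> p x (nth t0 v (index x A)).
Proof.
elim: A v => //= y A IH [//|z v] /andP[pyz pA]; rewrite inE eq_sym.
by case: eqP => [<- //|_] /=; apply: IH.
Qed.

Lemma all2_nthI (S : eqType) (T : Type) (p : S -> T -> bool) A v t0 :
  size A = size v -> uniq A -> {in A, forall x, p x (nth t0 v (index x A))} ->
  all2 p A v.
Proof.
elim: A v => [|y A IH] [|z v] //= [sz] /andP[yA uA] H.
have := H y (mem_head _ _); rewrite eqxx /= => -> /=.
apply: IH => // x xA; have := H x; rewrite inE xA orbT ifN => [/(_ isT)//|].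
by apply: contraNneq yA => ->.
Qed.

Lemma uniq_flattenI (T : eqType) (ss : seq (seq T)) :
  uniq ss -> {in ss, forall s, uniq s} ->
  (forall s s' x, s \in ss -> s' \in ss -> x \in s -> x \in s' -> s = s') ->
  uniq (flatten ss).
Proof.
elim: ss => //= s ss IH /andP[sN us] H D; rewrite cat_uniq H ?mem_head //=.
rewrite IH ?andbT => // [|s' s'ss|s1 s2 x s1s s2s].
- apply/hasPn => x /flattenP[s' s'ss xs']; apply: contra sN => xs.
  by rewrite (D s s' x) ?mem_head // inE s'ss orbT.
- by apply: H; rewrite inE s'ss orbT.
by apply: D; rewrite inE ?s1s ?s2s orbT.
Qed.

Section Instances.
Variables (Sg : finType) (rk : Sg -> nat) (NT : eqType) (G : mcftg NT Sg).
Variables (Delta : {set Sg}) (b : bool).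

(** The number of free positions due to C: one for slot 0 and one per hole. *)
Definition fan (C : NT) : nat := (nholes b (ntrk G C)).+1.

(* A place names a position: (true, C, sd, h) is the annotation of C in the   *)
(* left-hand side of a rule, and (false, C, sd, h) that in its links.         *)
Definition place : eqType := (bool * NT * bool * nat)%type.
Definition pl (k : bool) (C : NT) (sd : bool) (h : nat) : place := (k, C, sd, h).

Definition ptoks (r : rule NT Sg) : seq (tok Sg place) :=
  rule_toks b (pl true) (pl false) (lhs r) (rhs r).

(* The places at which the reading of the right-hand sides resumes. The other *)
(* places are a constant number of letters to the right of one of these.      *)
Definition free_places (r : rule NT Sg) : seq place :=
  [seq (true, C, 0 < h, h) | C <- lhs r, h <- iota 0 (fan C)] ++
  [seq (false, C, h == 0, h) | C <- flatten (links r), h <- iota 0 (fan C)].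

(** The loop variables come after the entries 0 and |w| of the environment, whence the offset 2. *)
Definition fvar (r : rule NT Sg) (x : place) : expr :=
  ((index x (free_places r)).+2, 0).

Definition advance (a : Sg) (cur : expr) : expr :=
  if a \in Delta then (cur.1, cur.2.+1) else cur.

(* The ends of the pieces, as expressions in terms of their beginnings.       *)
Fixpoint dets (f : place -> expr) (cur : expr) (s : seq (tok Sg place)) :=
  match s with
  | [::] => [::]
  | Let a :: s' => dets f (advance a cur) s'
  | Out x :: s' => (x, cur) :: dets f cur s'
  | In x :: s' => dets f (f x) s'
  end.

(** A place that is not free gets the expression recorded at its [Out] token, which by [detsP] has
    the right value in every successful run. *)
Definition where_is (r : rule NT Sg) (x : place) : expr :=
  if x \in free_places r then fvar r x else
  let D := dets (fvar r) (0, 0) (ptoks r) in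
  nth (0, 0) (unzip2 D) (index x (unzip1 D)).

Fixpoint checks (f : place -> expr) (cur : expr) (s : seq (tok Sg place)) :
    seq check :=
  match s with
  | [::] => [::]
  | Let a :: s' =>
      (if a \in Delta then [:: (true, cur, (0, enc_sym a))] else [::])
      ++ checks f (advance a cur) s'
  | Out x :: s' => (false, cur, f x) :: checks f cur s'
  | In x :: s' => checks f (f x) s'
  end.

Definition rule_checks (r : rule NT Sg) : seq check :=
  checks (where_is r) (0, 0) (ptoks r).

Definition env (w : seq Sg) (e : seq nat) : seq nat := [:: 0, size w & e].

Definition insts (w : seq Sg) : seq (rule NT Sg * seq nat) :=
  [seq (r, env w e) | r <- rules G,
     e <- [seq e <- envs (size w) (size (free_places r))
          | all (passes (enc_word w) (env w e)) (rule_checks r)]].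

Definition posn (r : rule NT Sg) (e : seq nat) (k : bool) C sd h : nat :=
  ev e (where_is r (k, C, sd, h)).

(** The checks contain no comparison with |w|: the bound that [In] tests is supplied by the
    hypothesis on the places in [ins s], and ultimately by the range of the loops. *)
Lemma checksP w e f cur s : nth 0 e 0 = 0 ->
  {in ins s, forall x, ev e (f x) <= size w} ->
  all (passes (enc_word w) e) (checks f cur s)
  = run Delta w (map (map_tok (ev e \o f)) s) (ev e cur) :> bool.
Proof.
move=> e0; elim: s cur => [//|[a|x|x] s IH] cur H.
- have {}IH := IH (advance a cur) H.
  rewrite /= all_cat IH /advance; case: (a \in Delta) => //=.
  rewrite /passes /= andbT {2}/ev /= e0 add0n.
  by case: eqP => //= _; rewrite /ev /= addnS.
- have {}IH := IH cur H.
  by rewrite /= IH {1}/passes /=; case: eqP.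
have {}IH : all (passes (enc_word w) e) (checks f (f x) s)
    = run Delta w (map (map_tok (ev e \o f)) s) (ev e (f x)) :> bool.
  by apply: IH => y ys; apply: H; rewrite inE ys orbT.
by rewrite /= IH H ?mem_head.
Qed.

(** Between two jumps the position grows by the number of letters of Delta that are read, so success
    forces the value of every [Out] place. *)
Lemma detsP w e (p : place -> nat) f cur s q :
  {in ins s, forall x, p x = ev e (f x)} ->
  run Delta w (map (map_tok p) s) (ev e cur) = Some q ->
  unzip1 (dets f cur s) = outs s
  /\ {in dets f cur s, forall d, p d.1 = ev e d.2}.
Proof.
elim: s cur => [//|[a|x|x] s IH] cur H /run_consP[p' Hs Hr] /=.
- apply: IH => //; rewrite (_ : ev e (advance a cur) = p') //; move: Hs => /=.
  rewrite /advance; case: ifP => _; last by case.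
  by case: eqP => // _ [<-]; rewrite /ev /= addnS.
- move: Hs Hr => /=; case: eqP => // px [<-] Hr.
  have [-> Hd] := IH cur H Hr; split=> // d; rewrite inE => /predU1P[->|] //.
  exact: Hd.
move: Hs Hr => /=; case: ifP => // _ [<-] Hr; apply: IH.
  by move=> y ys; apply: H; rewrite inE ys orbT.
by rewrite -H ?mem_head.
Qed.

Lemma map_seg (X Y : Type) (f : X -> Y) al h s :
  map (map_tok f) (seg al h s)
  = seg (fun sd h => f (al sd h)) h (map (@map_tok Sg _ _ f) s).
Proof. by rewrite /seg /= map_cat. Qed.

Lemma map_segs (X Y : Type) (f : X -> Y) al ss :
  map (map_tok f) (segs al ss)
  = segs (fun sd h => f (al sd h)) (map (map (@map_tok Sg _ _ f)) ss).
Proof.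
rewrite /segs map_flatten -map_comp size_map; congr flatten.
apply/eq_in_map => h; rewrite mem_iota => /andP[_ hs].
by rewrite (nth_map [::]) //; apply: map_seg.
Qed.

Lemma map_lin (X Y : Type) (f : X -> Y) be g t :
  map (map_tok f) (lin b be g t)
  = lin b (fun C sd h => f (be C sd h)) (map (map_tok f) \o g)
      (t : tree (NT + Sg)).
Proof.
elim/tree_ind_mem: t => // -[C|a] ts IH /=.
  congr (_ :: _); rewrite map_cat; congr (_ ++ _).
  have -> : map (lin b (fun C sd h => f (be C sd h)) (map (map_tok f) \o g)) ts
          = map (map (map_tok f)) (map (lin b be g) ts).
    by rewrite -map_comp; apply/eq_in_map => t tts; rewrite /= IH.
  rewrite [in RHS]groups_map; move: (groups b (map _ ts)) => ss.
  by rewrite map_segs; congr segs; elim: ss => //= x ss ->; rewrite map_flatten.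
congr (_ :: _); rewrite map_flatten -map_comp; congr flatten.
by apply/eq_in_map => t tts; rewrite /= IH.
Qed.

Lemma eq_lin_gaps X (be : NT -> bool -> nat -> X) g g' (t : tree (NT + Sg)) :
  g =1 g' -> lin b be g t = lin b be g' t.
Proof.
move=> E; elim/tree_ind_mem: t => // -[C|a] ts IH /=.
  by have -> : map (lin b be g) ts = map (lin b be g') ts by apply/eq_in_map.
by congr (_ :: flatten _); apply/eq_in_map.
Qed.

Lemma map_gaps (X Y : Type) (f : X -> Y) al h :
  map (map_tok f) (gaps b Sg al h) = gaps b Sg (fun sd h => f (al sd h)) h.
Proof. by rewrite /gaps /at_holes; case: ifP. Qed.

Lemma map_rule_toks (X Y : Type) (f : X -> Y) al be A (u : seq (tree (NT + Sg))) :
  map (map_tok f) (rule_toks b al be A u)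
  = rule_toks b (fun C sd h => f (al C sd h)) (fun C sd h => f (be C sd h)) A u.
Proof.
rewrite /rule_toks map_flatten -map_comp; congr flatten.
apply: eq_map => x; rewrite [LHS]map_seg map_lin; congr (seg _ _ _).
by apply: eq_lin_gaps => h; apply: map_gaps.
Qed.

(** Together with [mem_lin_outs], this shows that jumps lead to free places only, and that every
    other place is checked somewhere. *)
Lemma mem_lin_ins g t x : ranked (symrk rk G) t ->
  x \in ins (lin b (pl false) g t) ->
  (exists C h, [/\ C \in ntocc [:: t], h < fan C & x = (false, C, h == 0, h)])
  \/ exists2 i, i \in tvars t & x \in ins (g i).
Proof.
elim/tree_ind_mem: t => [i|f ts IH] /=.
  by move=> _ xi; right; exists i; rewrite ?mem_head.
case/andP=> /eqP sz rts.
have {}IH : {subset ntocc ts <= ntocc [:: Node f ts]} ->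
    x \in ins (flatten (map (lin b (pl false) g) ts)) -> 
    (exists C h, [/\ C \in ntocc [:: Node f ts], h < fan C & x = (false, C, h == 0, h)])
    \/ exists2 i, i \in flatten (map (@tvars _) ts) & x \in ins (g i).
  move=> subs /mem_ins_flatten[t tts /(IH t tts (allP rts t tts))].
  case=> [[C [h [Ct hC ->]]]|[i it xi]]; [left|right].
    by exists C, h; split=> //; apply/subs/(mem_ntocc tts).
  by exists i => //; apply/flatten_mapP; exists t.
case: f sz IH => [C|a] sz IH; last by apply: IH => C; rewrite ntocc_t.
rewrite /= ins_cat mem_cat => /orP[|]; last first.
  rewrite inE => /eqP->; left; exists C, 0; split=> //.
  by rewrite ntocc_nt mem_head.
rewrite /segs => /mem_ins_flatten[h]; rewrite mem_iota add0n ins_seg inE.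
rewrite size_map size_groups size_map sz => /andP[_ hs] /predU1P[->|].
  by left; exists C, h.+1; rewrite ntocc_nt mem_head.
rewrite (nth_map [::]) ?size_groups ?size_map ?sz // groups_map.
rewrite (nth_map [::]) ?size_groups ?sz // => /mem_ins_flatten[t tg xt].
apply: IH; first by move=> D; rewrite ntocc_nt inE orbC => ->.
have tts : t \in ts.
  rewrite -(flatten_groups b ts); apply/flattenP.
  by exists (nth [::] (groups b ts) h); rewrite ?mem_nth ?size_groups ?sz.
elim: ts tts {sz rts tg} => //= t' ts IH; rewrite inE ins_cat mem_cat.
by case/predU1P=> [<-|/IH->]; rewrite ?xt ?orbT.
Qed.

Lemma mem_lin_outs g t : ranked (symrk rk G) t ->
  {in ntocc [:: t], forall C h, h < fan C ->
     (false, C, 0 < h, h) \in outs (lin b (pl false) g t)}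
  /\ {in tvars t, forall i, {subset outs (g i) <= outs (lin b (pl false) g t)}}.
Proof.
elim/tree_ind_mem: t => [i|f ts IH] /=.
  by move=> _; split=> // j; rewrite inE => /eqP->.
case/andP=> /eqP sz rts.
pose sub x := exists2 t, t \in ts & x \in outs (lin b (pl false) g t).
have subN C h : C \in ntocc ts -> h < fan C -> sub (false, C, 0 < h, h).
  rewrite ntocc_map1 => /flatten_mapP[t tts Ct] hC; exists t => //.
  by have [H _] := IH t tts (allP rts t tts); apply: H.
have subV i x : i \in flatten (map (@tvars _) ts) -> x \in outs (g i) -> sub x.
  move=> /flatten_mapP[t tts it] xi; exists t => //.
  by have [_ H] := IH t tts (allP rts t tts); apply: H xi.
case: f sz => [C|a] sz; last first.
  have Hs x : sub x -> x \in outs (flatten (map (lin b (pl false) g) ts)).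
    by case=> t tts; apply: mem_outs_flatten tts _.
  split=> [C|i it x xi]; last by apply: Hs; apply: subV it xi.
  by rewrite ntocc_t => Cts h hC; apply: Hs; apply: subN.
set ss := map flatten _.
have szs : size ss = nholes b (ntrk G C) by rewrite size_map size_groups size_map sz.
have segE h x : h < nholes b (ntrk G C) ->
    x \in outs (seg (pl false C) h.+1 (nth [::] ss h)) ->
    x \in outs (segs (pl false C) ss).
  move=> hC; rewrite /segs; apply: mem_outs_flatten.
  by rewrite mem_iota szs.
have Hs x : sub x -> x \in outs (segs (pl false C) ss).
  case=> t tts xt; move: (tts); rewrite -(flatten_groups b ts) => /flattenP[u ug tu].
  have hu : index u (groups b ts) < nholes b (ntrk G C).
    by rewrite -[ntrk G C]sz -size_groups index_mem.
  apply: (segE _ _ hu); rewrite outs_seg mem_rcons inE; apply/orP; right.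
  rewrite (nth_map [::]) ?size_groups ?size_map ?sz // groups_map.
  rewrite (nth_map [::]) ?size_groups ?sz // nth_index //.
  exact: mem_outs_flatten tu _ xt.
rewrite /= outs_cat ntocc_nt; split=> [D|i it x xi]; last first.
  by rewrite inE mem_cat Hs ?orbT //; apply: subV it xi.
rewrite inE => /predU1P[->|Dts] h hD; last first.
  by rewrite inE mem_cat Hs ?orbT //; apply: subN.
case: h hD => [|h]; first by rewrite mem_head.
rewrite /fan ltnS => hC; rewrite inE mem_cat (segE h) ?orbT //.
by rewrite outs_seg mem_rcons mem_head.
Qed.

(** * Soundness and completeness of the instances of one rule *)

Hypothesis HG : is_mcftg rk G.
Variable r : rule NT Sg.
Hypothesis rG : r \in rules G.
Let Hr : is_rule rk G r := mcftg_rules HG rG.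

Lemma rule_ranked : all (ranked (symrk rk G)) (rhs r).
Proof. by apply: sub_all (rule_pattern Hr) => t /andP[]. Qed.

Lemma rule_size : size (lhs r) = size (rhs r).
Proof. by rewrite -(size_map (ntrk G)) -(rule_rank Hr) size_map. Qed.

Lemma zip_rule x : x \in zip (lhs r) (rhs r) ->
  [/\ x.1 \in lhs r, x.2 \in rhs r, ranked (symrk rk G) x.2 &
    perm_eq (tvars x.2) (iota 0 (ntrk G x.1))].
Proof.
case: x => A u xz; have Al : A \in lhs r.
  by rewrite -(unzip1_zip (eq_leq rule_size)); apply: (map_f fst xz).
have ur : u \in rhs r.
  by rewrite -(unzip2_zip (eq_leq (esym rule_size))); apply: (map_f snd xz).
split=> //=; first by rewrite (allP rule_ranked).
have /andP[_] := allP (rule_pattern Hr) _ ur; rewrite (_ : prank u = ntrk G A) //.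
have [i iz] := nthP (A, u) xz; rewrite nth_zip ?rule_size // => -[<- <-].
have ir : i < size (rhs r) by move: iz; rewrite size_zip rule_size minnn.
have := congr1 (fun s => nth 0 s i) (rule_rank Hr).
by rewrite (nth_map u) // (nth_map A) ?rule_size.
Qed.

Lemma ptoks_ins : {subset ins (ptoks r) <= free_places r}.
Proof.
move=> x /mem_ins_flatten[[A u] /zip_rule[Al ur ru pu]].
rewrite ins_seg inE mem_cat => /predU1P[->|].
  by apply/orP; left; apply/allpairsPdep; exists A, 0.
case/(mem_lin_ins ru) => [[C [h [Cu hC ->]]]|[i iu /(ins_gaps (k := ntrk G A))[]]].
- apply/orP; right; apply/allpairsPdep; exists C, h; rewrite mem_iota; split=> //.
  by rewrite (rule_links_cover Hr) (mem_ntocc ur).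
- by move: iu; rewrite (perm_mem pu) mem_iota.
move=> h hA ->; apply/orP; left; apply/allpairsPdep; exists A, h.+1.
by rewrite mem_iota.
Qed.

Lemma ptoks_outs_lhs A h : A \in lhs r -> h < fan A ->
  (true, A, h == 0, h) \in outs (ptoks r).
Proof.
rewrite -{1}(unzip1_zip (eq_leq rule_size)) => /mapP[[A' u] xz ->] hA.
rewrite /ptoks /rule_toks; apply: (mem_outs_flatten xz); rewrite outs_seg mem_rcons inE.
case: h hA => [_|h hA]; first by apply/orP; left.
have [Al ur ru pu] := zip_rule xz.
have [hk Hh] := outs_gaps Sg (pl true A') (hA : h < nholes b (ntrk G A')).
apply/orP; right; have [_ H] := mem_lin_outs (gaps b Sg (pl true A')) ru.
by apply: H Hh; rewrite (perm_mem pu) mem_iota.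
Qed.

Lemma ptoks_outs_links C h : C \in flatten (links r) -> h < fan C ->
  (false, C, 0 < h, h) \in outs (ptoks r).
Proof.
rewrite (rule_links_cover Hr) ntocc_map1 => /flatten_mapP[u ur Cu] hC.
move: ur; rewrite -(unzip2_zip (eq_leq (esym rule_size))) => /mapP[[A u'] xz uE].
move: uE Cu => /= -> Cu.
rewrite /ptoks /rule_toks; apply: (mem_outs_flatten xz); rewrite outs_seg mem_rcons inE.
have [Al ur ru pu] := zip_rule xz; apply/orP; right.
have [H _] := mem_lin_outs (gaps b Sg (pl true A)) ru.
exact: H.
Qed.

Lemma place_lhs A sd h : A \in lhs r -> h < fan A ->
  (true, A, sd, h) \in free_places r \/ (true, A, sd, h) \in outs (ptoks r).
Proof.
move=> Al hA; have [->|/negbTE sdN] := eqVneq sd (0 < h).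
  left; rewrite mem_cat; apply/orP; left; apply/allpairsPdep.
  by exists A, h; rewrite mem_iota.
right; rewrite (_ : sd = (h == 0)); first exact: ptoks_outs_lhs.
by case: sd h sdN {hA} => [] [].
Qed.

Lemma place_links C sd h : C \in flatten (links r) -> h < fan C ->
  (false, C, sd, h) \in free_places r \/ (false, C, sd, h) \in outs (ptoks r).
Proof.
move=> Cl hC; have [->|/negbTE sdN] := eqVneq sd (h == 0).
  left; rewrite mem_cat; apply/orP; right; apply/allpairsPdep.
  by exists C, h; rewrite mem_iota.
right; rewrite (_ : sd = (0 < h)); first exact: ptoks_outs_links.
by case: sd h sdN {hC} => [] [].
Qed.

Variable w : seq Sg.

Definition values (A : seq NT) (v : seq (tree Sg)) : bool :=
  all2 (fun C t => is_value b (ntrk G C) t) A v.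

Definition sem (al : NT -> bool -> nat -> nat) (A : seq NT)
    (v : seq (tree Sg)) : bool :=
  all2 (spansb Delta w b al) A v.

(** Annotations are total functions, of which only the slots below [fan C] carry meaning. *)
Definition agree (A : seq NT) (al al' : NT -> bool -> nat -> nat) : Prop :=
  {in A, forall C sd h, h < fan C -> al C sd h = al' C sd h}.

Lemma eq_spansb al al' C t : is_value b (ntrk G C) t ->
  (forall sd h, h < fan C -> al C sd h = al' C sd h) ->
  spansb Delta w b al C t = spansb Delta w b al' C t.
Proof.
case/andP=> pt _ H; rewrite /spansb !H //.
rewrite (eq_glin (g' := gaps b Sg (al' C))) // => i.
rewrite (perm_mem pt) mem_iota => /= it.
rewrite /gaps /at_holes; case: ifP => // hi.
by rewrite !H // ltnS -is_hole_lt hi.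
Qed.

Lemma sem_agree al al' A v : values A v -> agree A al al' -> sem al A v -> sem al' A v.
Proof.
move=> Hv H; elim: A v Hv H => [|C A IH] [|t v] //= /andP[Hv Hvs] H /andP[].
rewrite (eq_spansb Hv (H C (mem_head _ _))) => -> /=; apply: IH => // D DA.
by apply: H; rewrite inE DA orbT.
Qed.

Variable vs : seq (seq (tree Sg)).
Hypothesis Hvs : all2 values (links r) vs.
Local Notation vv C := (nth (Var 0) (flatten vs) (index C (flatten (links r)))).

Lemma link_values : {in ntocc (rhs r), forall C, is_value b (ntrk G C) (vv C)}.
Proof.
move=> C; rewrite -(rule_links_cover Hr) => Cl.
apply: (all2_nth (p := fun C t => is_value b (ntrk G C) t)) Cl.
by rewrite (all2_flatten _ Hvs).
Qed.

Lemma uniq_links : uniq (flatten (links r)).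
Proof.
apply: uniq_flattenI; first exact: rule_links_uniq Hr.
  by move=> B /(rule_links Hr) /(mcftg_bigs HG)[].
exact: rule_links_disj Hr.
Qed.

Lemma instP e : (r, e) \in insts w -> exists2 e0,
  e = env w e0 /\ e0 \in envs (size w) (size (free_places r))
  & all (passes (enc_word w) (env w e0)) (rule_checks r).
Proof.
by case/allpairsPdep=> r' [e0 [_]]; rewrite mem_filter => /andP[Hc He] [-> ->]; exists e0.
Qed.

Lemma nth_envs n m e i : e \in envs n m -> nth 0 e i <= n.
Proof.
rewrite mem_envs => /andP[/eqP se /allP He].
have [lt|le] := ltnP i (size e); first by apply: He; apply: mem_nth.
by rewrite nth_default.
Qed.

Lemma inst_sound e : (r, e) \in insts w ->
  all2 (sem (posn r e false)) (links r) vs ->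
  sem (posn r e true) (lhs r) (fsubst (links r) vs (rhs r)).
Proof.
case/instP=> e0 [-> He] Hc Hs.
have Hins : {in ins (ptoks r), forall x, ev (env w e0) (where_is r x) <= size w}.
  move=> x /ptoks_ins xf; rewrite /where_is xf /ev /= addn0.
  exact: nth_envs He.
move: Hc; rewrite (checksP _ _ Hins) // map_rule_toks.
case E: (run _ _ _ _) => [q|] // _.
apply: (rule_toks_sound (rk := rk) (G := G)) E => //.
- exact: rule_size.
- exact: rule_ranked.
move=> C Cr; split; first exact: link_values.
have Hf : sem (posn r (env w e0) false) (flatten (links r)) (flatten vs).
  by rewrite /sem (all2_flatten _ Hvs).
rewrite -(rule_links_cover Hr) in Cr.
by have /spansP := all2_nth (Var 0) Hf Cr.
Qed.

(** The loop variables take the values that the given annotation of the left-hand side, and the one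
    of the links from [rule_toks_complete], assign to the free places. By [detsP], the expressions
    of the other places then evaluate correctly too. *)
Lemma inst_complete al : bounded w al ->
  sem al (lhs r) (fsubst (links r) vs (rhs r)) ->
  exists e be, [/\ (r, e) \in insts w, agree (lhs r) (posn r e true) al,
    bounded w be, agree (flatten (links r)) (posn r e false) be
    & all2 (sem be) (links r) vs].
Proof.
move=> nal Hs.
have [be nbe [[q Hq] Hbe]] :=
  rule_toks_complete 0 nal rule_size rule_ranked (rule_unique Hr) link_values Hs.
pose p (x : place) := (if x.1.1.1 then al else be) x.1.1.2 x.1.2 x.2.
pose e0 := map p (free_places r).
have np x : p x <= size w by rewrite /p; case: ifP.
have He : e0 \in envs (size w) (size (free_places r)).
  by rewrite mem_envs size_map eqxx /=; apply/allP => y /mapP[x _ ->].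
have Hfree x : x \in free_places r -> ev (env w e0) (fvar r x) = p x.
  move=> xf; rewrite /ev /= addn0 (nth_map x) ?index_mem // nth_index //.
have Hq' : run Delta w (map (map_tok p) (ptoks r)) (ev (env w e0) (0, 0)) = Some q.
  by rewrite -Hq; congr run; apply: map_rule_toks.
have [Ho Hd] := detsP (fun x xi => esym (Hfree x (ptoks_ins xi))) Hq'.
have Hwhere x : x \in free_places r \/ x \in outs (ptoks r) ->
    ev (env w e0) (where_is r x) = p x.
  rewrite /where_is; case: ifP => [/Hfree -> //|_] [//|].
  set D := dets _ _ _ in Ho Hd *; rewrite -Ho => xo.
  have xD : index x (unzip1 D) < size D by rewrite -(size_map fst) index_mem.
  have := Hd _ (mem_nth (x, (0, 0)) xD).
  rewrite -(nth_map _ x fst) // nth_index // => ->.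
  by rewrite -(nth_map _ (0, 0) snd).
exists (env w e0), be; split=> //.
- apply/allpairsPdep; exists r, e0; split=> //.
  rewrite mem_filter He andbT /rule_checks checksP //; last first.
    by move=> x /ptoks_ins xf; rewrite Hwhere ?np //; left.
  rewrite (_ : map _ (ptoks r) = map (map_tok p) (ptoks r)) ?Hq' //.
  have {}Hwhere x : x \in ins (ptoks r) \/ x \in outs (ptoks r) ->
      ev (env w e0) (where_is r x) = p x.
    by case=> H; apply: Hwhere; [left; apply: ptoks_ins|right].
  elim: (ptoks r) Hwhere => // k s IH H; rewrite [LHS]/= [RHS]/=; congr (_ :: _).
    by case: k H => //= x H; rewrite H //= mem_head; auto.
  apply: IH => x xs; apply: H; rewrite -cat1s ins_cat outs_cat !mem_cat.
  by case: xs => ->; rewrite ?orbT; auto.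
- by move=> C Cl sd h hC; rewrite /posn Hwhere //; apply: place_lhs.
- by move=> C Cl sd h hC; rewrite /posn Hwhere //; apply: place_links.
rewrite -(all2_flatten _ Hvs); apply: (all2_nthI (t0 := Var 0)).
- exact: size_all2_flatten Hvs.
- exact: uniq_links.
by move=> C Cl; apply/spansP/Hbe; rewrite -(rule_links_cover Hr).
Qed.

Lemma rule_values : (b -> footed rk G) ->
  values (lhs r) (fsubst (links r) vs (rhs r)).
Proof.
move=> Hft; rewrite /values /fsubst all2E size_map rule_size eqxx /=.
apply/allP => x; rewrite zip_mapr => /mapP[[A u] xz ->].
have [_ ur ru pu] := zip_rule xz.
have pk : prank u = ntrk G A by move: (perm_size pu); rewrite size_iota.
suff: is_value b (ntrk G A) (subst (flatten (links r)) (flatten vs) u) by [].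
rewrite -pk; apply: (subst_value (rk := rk)); first exact: (allP (rule_pattern Hr)).
  by move=> /Hft /(_ r rG) /allP; apply.
by move=> C Cu; apply: link_values; apply: mem_ntocc ur _ Cu.
Qed.
End Instances.

(** * The grammars H_w and G_w *)

Section RunWord.
Variables (Sg : finType) (Delta : {set Sg}) (w : seq Sg).

Lemma run_let s p : p <= size w -> run Delta w (map Let s) p =
  if prefix [seq a <- s | a \in Delta] (drop p w)
  then Some (p + size [seq a <- s | a \in Delta]) else None.
Proof.
elim: s p => [|a s IH] p pn; first by rewrite prefix0s addn0.
rewrite /=; case: ifP => aD; last exact: IH.
have [pw|wp] := ltnP p (size w); last first.
  by rewrite nth_default ?size_map // drop_oversize //= eqn0Ngt.
rewrite (drop_nth a pw) /enc_word (nth_map a) //= /enc_sym eqSS.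
rewrite (inj_eq val_inj) (inj_eq enum_rank_inj) eq_sym.
by case: eqP => //= _; rewrite IH // addSnnS.
Qed.

Lemma run_word s :
  run Delta w (map Let s) 0 = Some (size w) <-> [seq a <- s | a \in Delta] = w.
Proof.
rewrite run_let // drop0; split=> [|->]; last by rewrite prefix_refl.
case: ifP => // /prefixP[s' ->] [/eqP].
by rewrite size_cat add0n -{1}[size _]addn0 eqn_add2l eq_sym => /nilP->; rewrite cats0.
Qed.

Lemma tstr_labels (t : tree Sg) : tvars t = [::] -> tstr t = map inl (labels t).
Proof.
elim/tree_ind_mem: t => // a ts IH /= vs; congr (_ :: _).
elim: ts IH vs => //= t ts IHts IH /eqP.
rewrite -size_eq0 size_cat addn_eq0 !size_eq0 => /andP[/eqP vt /eqP vts].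
rewrite map_cat IH ?mem_head // IHts // => t' t's; apply: IH.
by rewrite inE t's orbT.
Qed.
End RunWord.

Section Grammars.
Variables (Sg : finType) (rk : Sg -> nat) (NT : eqType) (G : mcftg NT Sg).
Variables (Delta : {set Sg}) (b : bool).
Hypothesis HG : is_mcftg rk G.
Hypothesis Hb : b -> footed rk G.

Local Notation fan := (fan G b).
Local Notation values := (values G b).
Local Notation agree := (agree G b).
Local Notation posn := (posn G Delta b).

Lemma lang_values A v : lang G A v -> values A v.
Proof.
elim=> r f rG _ IH; apply: (rule_values HG rG _ Hb).
elim: (links r) IH => //= B Bs IH H.
rewrite H ?mem_head // IH // => B' B's; apply: H; by rewrite inE B's orbT.
Qed.

Lemma all2_nthP (S T : Type) (p : S -> T -> bool) A v x0 t0 :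
  size A = size v -> (forall i, i < size A -> p (nth x0 A i) (nth t0 v i)) ->
  all2 p A v.
Proof.
elim: A v => [|x A IH] [|t v] //= [sz] H; rewrite (H 0) //=.
by apply: IH => // i iA; apply: (H i.+1).
Qed.

Lemma der_values A d : der G A d -> values A (dval d).
Proof.
elim=> r ds rG sz _ IH; apply: (rule_values HG rG _ Hb).
apply: (all2_nthP (x0 := [::]) (t0 := [::])); first by rewrite size_map sz.
by move=> i ir; rewrite (nth_map (Var 0)) ?sz //; apply: IH.
Qed.

Definition slots (A : seq NT) : seq (NT * (bool * nat)) :=
  [seq (C, k) | C <- A,
     k <- [seq (sd, h) | sd <- [:: false; true], h <- iota 0 (fan C)]].

Lemma mem_slots A C sd h : ((C, (sd, h)) \in slots A) = (C \in A) && (h < fan C).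
Proof.
apply/allpairsPdep/andP=> [[C' [k [CA]]]|[CA hC]].
  case/allpairsPdep=> sd' [h' [_ hC ->]] [-> _ ->].
  by move: hC; rewrite mem_iota.
exists C, (sd, h); split=> //; apply/allpairsPdep; exists sd, h.
by rewrite mem_iota hC; case: sd.
Qed.

(** The meaningful slots of an annotation, listed so that they fit into a name. *)
Definition vec (X : Type) (al : NT -> bool -> nat -> X) (A : seq NT) : seq X :=
  [seq al x.1 x.2.1 x.2.2 | x <- slots A].

Lemma vecP al al' A : vec al A = vec al' A <-> agree A al al'.
Proof.
split=> [/eq_in_map H C CA sd h hC|H].
  by apply: (H (C, (sd, h))); rewrite mem_slots CA.
apply/eq_in_map => -[C [sd h]]; rewrite mem_slots => /andP[CA hC].
exact: H.
Qed.

(* A nonterminal of H_w names a big nonterminal A and the positions v of its  *)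
(* annotation, and one of G_w moreover a component C of A. The parameter K    *)
(* embeds the numbers into the type of positions, which are either numbers or *)
(* expressions.                                                               *)
Definition rname (X : Type) (K : nat -> X) (A : seq NT) (v : seq X) : seq X :=
  K (index A (bigs G)) :: v.
Definition cname (X : Type) (K : nat -> X) A v C : seq X :=
  K (index C A) :: rname K A v.
Definition bname (X : Type) (K : nat -> X) A v := [seq cname K A v C | C <- A].

Definition unname (nm : name) : NT :=
  nth (start G) (nth [::] (bigs G) (nth 0 nm 1)) (nth 0 nm 0).

Lemma index_inj (T : eqType) (s : seq T) x y :
  x \in s -> y \in s -> index x s = index y s -> x = y.
Proof. by move=> xs ys E; rewrite -(nth_index x xs) E nth_index. Qed.

Lemma rname_inj A A' v v' : A \in bigs G -> A' \in bigs G ->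
  rname id A v = rname id A' v' -> A = A' /\ v = v'.
Proof. by move=> AG A'G [/(index_inj AG A'G) -> ->]. Qed.

Lemma cname_inj A A' v v' C C' : A \in bigs G -> A' \in bigs G ->
  C \in A -> C' \in A' -> cname id A v C = cname id A' v' C' ->
  [/\ A = A', v = v' & C = C'].
Proof.
move=> AG A'G CA C'A [E1 E2 ->]; have AA := index_inj AG A'G E2.
by split=> //; move: C'A E1; rewrite -AA => C'A /(index_inj CA C'A).
Qed.

Lemma unname_cname A v C : A \in bigs G -> C \in A -> unname (cname id A v C) = C.
Proof. by move=> AG CA; rewrite /unname /= !nth_index. Qed.

Lemma unname_bname A v : A \in bigs G -> map unname (bname id A v) = A.
Proof.
move=> AG; rewrite -map_comp -[RHS]map_id; apply/eq_in_map => C CA.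
exact: unname_cname.
Qed.

Lemma bname_inj A A' v v' : A \in bigs G -> A' \in bigs G ->
  bname id A v = bname id A' v' -> A = A' /\ v = v'.
Proof.
move=> AG A'G; have [A0 _ _] := mcftg_bigs HG AG.
have [A'0 _ _] := mcftg_bigs HG A'G.
case: A A' A0 A'0 AG A'G => [|C A] [|C' A'] // _ _ AG A'G.
move/(congr1 (head [::])) => E.
by case: (cname_inj AG A'G (mem_head _ _) (mem_head _ _) E).
Qed.

Definition al0 (w : seq Sg) (C : NT) (sd : bool) (h : nat) : nat :=
  if sd then size w else 0.

Definition rpos r e := vec (posn r e true) (lhs r).
Definition lpos r e B := vec (posn r e false) B.

Definition inst_bigs (x : rule NT Sg * seq nat) : seq (seq NT * seq nat) :=
  (lhs x.1, rpos x.1 x.2) :: [seq (B, lpos x.1 x.2 B) | B <- links x.1].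

Definition start_big (w : seq Sg) : seq NT * seq nat :=
  ([:: start G], vec (al0 w) [:: start G]).

Local Notation insts := (insts G Delta b).

(** Only annotations that occur in instances are listed, so that the loops over the instances can
    print them. Running through all annotations would take two positions per slot, which for
    rule-width 0 may exceed the degree. *)
Definition annotated (w : seq Sg) : seq (seq NT * seq nat) :=
  start_big w :: flatten [seq inst_bigs x | x <- insts w].

Definition inst_rrule (x : rule NT Sg * seq nat) :=
  (rname id (lhs x.1) (rpos x.1 x.2), x.1,
   [seq rname id B (lpos x.1 x.2 B) | B <- links x.1]).

Definition Hw (w : seq Sg) : rtg name (rule NT Sg) :=
  RTG [seq rname id x.1 x.2 | x <- annotated w]
      (rname id (start_big w).1 (start_big w).2)
      [seq inst_rrule x | x <- insts w].

Fixpoint tmap (F F' : Type) (f : F -> F') (t : tree F) : tree F' :=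
  match t with
  | Var i => Var i
  | Node a ts => Node (f a) (map (tmap f) ts)
  end.

Definition link_of (r : rule NT Sg) (C : NT) : seq NT :=
  nth [::] (links r) (find (fun B : seq NT => C \in B) (links r)).

Definition lname r e C : name := cname id (link_of r C) (lpos r e (link_of r C)) C.

Definition relabel (A B : Type) (f : A -> B) (a : A + Sg) : B + Sg :=
  match a with inl C => inl (f C) | inr a => inr a end.

Definition inst_rule (x : rule NT Sg * seq nat) : rule name Sg :=
  (bname id (lhs x.1) (rpos x.1 x.2),
   [seq tmap (relabel (lname x.1 x.2)) t | t <- rhs x.1],
   [seq bname id B (lpos x.1 x.2 B) | B <- links x.1]).

Definition Gw (w : seq Sg) : mcftg name Sg :=
  MCFTG (flatten [seq bname id x.1 x.2 | x <- annotated w])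
        (fun nm => ntrk G (unname nm))
        [seq bname id x.1 x.2 | x <- annotated w]
        (cname id (start_big w).1 (start_big w).2 (start G))
        [seq inst_rule x | x <- insts w].

Lemma inst_rules w x : x \in insts w -> x.1 \in rules G.
Proof. by case/allpairsPdep=> r [e0 [rG _ ->]]. Qed.

Lemma lhs_bigs r : r \in rules G -> lhs r \in bigs G.
Proof. by move=> rG; apply: rule_lhs (mcftg_rules HG rG). Qed.

Lemma link_bigs r B : r \in rules G -> B \in links r -> B \in bigs G.
Proof. by move=> rG; apply: rule_links (mcftg_rules HG rG) _. Qed.

Lemma link_of_eq r B C : r \in rules G -> B \in links r -> C \in B ->
  link_of r C = B.
Proof.
move=> rG Bl CB; have hB : has (fun B : seq NT => C \in B) (links r).
  by apply/hasP; exists B.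
have Cl : C \in link_of r C by apply: (nth_find [::] hB).
apply: (rule_links_disj (mcftg_rules HG rG)) Bl Cl CB.
by apply: mem_nth; rewrite -has_find.
Qed.

(** The annotation is quantified inside the induction because a name determines it only up to
    [agree]. *)
Lemma rtg_sound w nm d : rtg_lang (Hw w) nm d -> forall A al,
  A \in bigs G -> nm = rname id A (vec al A) ->
  der G A d /\ sem Delta b w al A (dval d).
Proof.
elim=> {nm d} rr ts /mapP[[r e] re ->] /=; rewrite size_map => sz _ IH A al AG.
have rG := inst_rules re; case/(rname_inj (lhs_bigs rG) AG) => <- /vecP agr.
have {}IH i : i < size (links r) -> 
    der G (nth [::] (links r) i) (nth (Var 0) ts i) /\
    sem Delta b w (posn r e false) (nth [::] (links r) i) (dval (nth (Var 0) ts i)).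
  move=> ir; apply: (IH i ir); first exact: link_bigs rG (mem_nth [::] ir).
  by rewrite (nth_map [::]).
have Hd : der G (lhs r) (Node r ts) by apply: DerRule => // i /IH[].
split=> //; apply: (sem_agree (der_values Hd) agr).
apply: (inst_sound HG rG _ re).
  apply: (all2_nthP (x0 := [::]) (t0 := [::])); first by rewrite size_map sz.
  by move=> i ir; rewrite (nth_map (Var 0)) ?sz //; apply: der_values; case: (IH i ir).
apply: (all2_nthP (x0 := [::]) (t0 := [::])); first by rewrite size_map sz.
by move=> i ir; rewrite (nth_map (Var 0)) ?sz //; case: (IH i ir).
Qed.

Lemma all2_nthE (S T : Type) (p : S -> T -> bool) A v x0 t0 i :
  all2 p A v -> i < size A -> p (nth x0 A i) (nth t0 v i).
Proof.
by elim: A v i => [|x A IH] [|t v] [|i] //= /andP[// _ pA] iA; apply: IH.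
Qed.

(** The annotation is built top-down: given the one of the left-hand side, [inst_complete] supplies
    those of the links. *)
Lemma rtg_complete w A d : der G A d -> forall al,
  bounded w al -> sem Delta b w al A (dval d) ->
  rtg_lang (Hw w) (rname id A (vec al A)) d.
Proof.
elim=> {A d} r ds rG sz Hds IH al nal Hs.
have Hv : all2 values (links r) (map (@dval _ _) ds).
  apply: (all2_nthP (x0 := [::]) (t0 := [::])); first by rewrite size_map sz.
  by move=> i ir; rewrite (nth_map (Var 0)) ?sz //; apply: der_values; apply: Hds.
have [e [be [re agr nbe agrl Hl]]] := inst_complete HG rG Hv nal Hs.
have -> : vec al (lhs r) = rpos r e by apply/esym/vecP.
have := @RtgRule _ _ (Hw w) (inst_rrule (r, e)) ds; apply => /=.
- by apply/mapP; exists (r, e).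
- by rewrite size_map.
move=> i; rewrite size_map => ir; rewrite (nth_map [::]) //.
set B := nth _ _ _; have BL : B \in links r by apply: mem_nth.
have -> : lpos r e B = vec be B.
  apply/vecP => C CB; apply: agrl; apply/flattenP; by exists B.
apply: IH => //; have := all2_nthE [::] [::] Hl ir.
by rewrite (nth_map (Var 0)) ?sz.
Qed.

Lemma labels_tmap (F F' : eqType) (f : F -> F') t : labels (tmap f t) = map f (labels t).
Proof.
elim/tree_ind_mem: t => //= a ts IH; congr (_ :: _).
rewrite map_flatten -!map_comp; congr flatten.
by apply/eq_in_map => t tts; apply: IH.
Qed.

Lemma tvars_tmap (F F' : eqType) (f : F -> F') t : tvars (tmap f t) = tvars t.
Proof.
elim/tree_ind_mem: t => //= a ts IH; rewrite -map_comp; congr flatten.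
by apply/eq_in_map => t tts; apply: IH.
Qed.

Lemma ntocc_relabel (A B : eqType) (f : A -> B) (u : seq (tree (A + Sg))) :
  ntocc (map (tmap (relabel f)) u) = map f (ntocc u).
Proof.
rewrite /ntocc /flabels; elim: u => //= t u IH.
rewrite !pmap_cat map_cat IH labels_tmap; congr (_ ++ _).
by elim: (labels t) => //= -[C|a] s ->.
Qed.

Lemma tmap_relabelK (A B : eqType) (f : A -> B) g (t : tree (A + Sg)) :
  {in ntocc [:: t], cancel f g} -> tmap (relabel g) (tmap (relabel f) t) = t.
Proof.
elim/tree_ind_mem: t => // -[C|a] ts IH H /=.
  rewrite ntocc_nt in H; rewrite H ?mem_head // -map_comp; congr Node.
  rewrite -[RHS]map_id; apply/eq_in_map => t tts; apply: IH => // D Dt.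
  by apply: H; rewrite inE (mem_ntocc tts) ?orbT.
rewrite ntocc_t in H; rewrite -map_comp; congr Node.
rewrite -[RHS]map_id; apply/eq_in_map => t tts; apply: IH => // D Dt.
by apply: H; apply: mem_ntocc tts _ Dt.
Qed.

Lemma index_map_in (A B : eqType) (f : A -> B) s x :
  {in s &, injective f} -> x \in s -> index (f x) (map f s) = index x s.
Proof.
elim: s => //= y s IH H xs; have ys : y \in y :: s by rewrite mem_head.
rewrite (inj_in_eq H ys xs); move: xs; rewrite inE eq_sym.
case: eqP => //= _ xs; rewrite IH // => z z' zs z's.
by apply: H; rewrite inE ?zs ?z's orbT.
Qed.

Lemma subst_relabel (A B : eqType) (f : A -> B) sigma v (t : tree (A + Sg)) :
  {in sigma &, injective f} -> {subset ntocc [:: t] <= sigma} ->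
  subst (map f sigma) v (tmap (relabel f) t) = subst sigma v t.
Proof.
move=> Hf; elim/tree_ind_mem: t => // -[C|a] ts IH H /=.
  rewrite ntocc_nt in H; rewrite index_map_in ?H ?mem_head //; congr plug.
  rewrite -map_comp; apply/eq_in_map => t tts; apply: IH => // D Dt.
  by apply: H; rewrite inE (mem_ntocc tts) ?orbT.
rewrite ntocc_t in H; congr Node; rewrite -map_comp.
apply/eq_in_map => t tts; apply: IH => // D Dt.
by apply: H; apply: mem_ntocc tts _ Dt.
Qed.

Section InstanceRule.
Variables (w : seq Sg) (r : rule NT Sg) (e : seq nat).
Hypothesis re : (r, e) \in insts w.
Let rG : r \in rules G := inst_rules re.
Let Hr : is_rule rk G r := mcftg_rules HG rG.

Lemma lname_link B C : B \in links r -> C \in B ->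
  lname r e C = cname id B (lpos r e B) C.
Proof. by move=> Bl CB; rewrite /lname (link_of_eq rG Bl CB). Qed.

Lemma unname_lname : {in flatten (links r), cancel (lname r e) unname}.
Proof.
move=> C /flattenP[B Bl CB]; rewrite (lname_link Bl CB) unname_cname //.
exact: link_bigs Bl.
Qed.

Lemma lname_inj : {in flatten (links r) &, injective (lname r e)}.
Proof.
by move=> C D Cl Dl E; rewrite -(unname_lname Cl) E unname_lname.
Qed.

Lemma inst_links_flatten :
  flatten (links (inst_rule (r, e))) = map (lname r e) (flatten (links r)).
Proof.
rewrite map_flatten /=; congr flatten; apply/eq_in_map => B Bl.
by apply/eq_in_map => C CB; rewrite (lname_link Bl CB).
Qed.

Lemma ntocc_links u : u \in rhs r -> {subset ntocc [:: u] <= flatten (links r)}.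
Proof. by move=> ur C /(mem_ntocc ur); rewrite -(rule_links_cover Hr). Qed.

Lemma fsubst_inst vs :
  fsubst (links (inst_rule (r, e))) vs (rhs (inst_rule (r, e)))
  = fsubst (links r) vs (rhs r).
Proof.
rewrite /fsubst inst_links_flatten /= -map_comp; apply/eq_in_map => u ur.
exact: subst_relabel lname_inj (ntocc_links ur).
Qed.

Lemma ranked_inst u : {subset ntocc [:: u] <= flatten (links r)} ->
  ranked (symrk rk G) u ->
  ranked (symrk rk (Gw w)) (tmap (relabel (lname r e)) u).
Proof.
elim/tree_ind_mem: u => // f ts IH H /= /andP[/eqP sz rts].
rewrite size_map all_map sz; apply/andP; split.
  case: f H sz => [C|a] H sz //=.
  by rewrite unname_lname // H // ntocc_nt mem_head.
apply/allP => t tts /=; apply: IH => //; last exact: (allP rts).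
move=> C Ct; apply: H; have := mem_ntocc tts Ct.
by case: f {sz} => [D|a]; rewrite ?ntocc_nt ?ntocc_t // inE orbC => ->.
Qed.

Lemma annotated_inst x : x \in inst_bigs (r, e) -> x \in annotated w.
Proof.
by move=> xi; rewrite inE; apply/orP; right; apply/flatten_mapP; exists (r, e).
Qed.

Lemma bname_annotated x : x \in inst_bigs (r, e) -> bname id x.1 x.2 \in bigs (Gw w).
Proof. by move=> /annotated_inst xa; apply: map_f xa. Qed.

Lemma lname_nts C : C \in flatten (links r) -> lname r e C \in nts (Gw w).
Proof.
case/flattenP=> B Bl CB; rewrite (lname_link Bl CB); apply/flatten_mapP.
exists (B, lpos r e B); last exact: map_f.
by apply: annotated_inst; rewrite inE; apply/orP; right; apply: map_f.
Qed.

Lemma inst_is_rule : is_rule rk (Gw w) (inst_rule (r, e)).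
Proof.
have lE : lhs (inst_rule (r, e)) = bname id (lhs r) (rpos r e) by [].
have uE : rhs (inst_rule (r, e)) = map (tmap (relabel (lname r e))) (rhs r) by [].
have LE : links (inst_rule (r, e)) = [seq bname id B (lpos r e B) | B <- links r].
  by [].
split; last rewrite inst_links_flatten; rewrite ?lE ?uE ?LE.
- exact: (bname_annotated (x := (lhs r, rpos r e)) (mem_head _ _)).
- by have := rule_nonempty Hr; case: (rhs r).
- apply/allP => _ /mapP[u ur ->]; have /andP[ru pu] := allP (rule_pattern Hr) u ur.
  rewrite /pattern /prank tvars_tmap pu andbT; apply: ranked_inst ru.
  exact: ntocc_links.
- move=> X; rewrite ntocc_relabel => /mapP[C Cr ->]; apply: lname_nts.
  by rewrite (rule_links_cover Hr).
- rewrite ntocc_relabel map_inj_in_uniq ?(rule_unique Hr) // => C D Cr Dr.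
  by apply: lname_inj; rewrite (rule_links_cover Hr).
- rewrite -!map_comp (eq_map (g := @prank _)); last first.
    by move=> t; rewrite /= /prank tvars_tmap.
  rewrite (rule_rank Hr); apply/eq_in_map => C CA /=.
  by rewrite unname_cname // lhs_bigs.
- move=> _ /mapP[B Bl ->].
  apply: (bname_annotated (x := (B, lpos r e B))).
  by rewrite inE; apply/orP; right; apply: map_f.
- rewrite map_inj_in_uniq ?(rule_links_uniq Hr) // => B B' Bl B'l E.
  by case: (bname_inj (link_bigs rG Bl) (link_bigs rG B'l) E).
- move=> _ _ X /mapP[B Bl ->] /mapP[B' B'l ->] /mapP[C CB ->] /mapP[C' C'B' E].
  by have [-> _ _] := cname_inj (link_bigs rG Bl) (link_bigs rG B'l) CB C'B' E.
move=> X; rewrite ntocc_relabel.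
exact: eq_mem_map (rule_links_cover Hr) X.
Qed.
End InstanceRule.

Lemma annotated_bigs w x : x \in annotated w -> x.1 \in bigs G.
Proof.
rewrite inE => /predU1P[->|/flatten_mapP[[r e] /inst_rules rG]].
  exact: mcftg_start HG.
by rewrite inE => /predU1P[->|/mapP[B Bl ->]]; [apply: lhs_bigs|apply: link_bigs Bl].
Qed.

Lemma Hw_is_rtg w : is_rtg (rules G) (@rule_arity NT Sg) (Hw w).
Proof.
split=> [|_ /mapP[[r e] re ->]]; first by rewrite /= mem_head.
rewrite /Hw; split.
- apply/mapP; exists (lhs r, rpos r e) => //.
  exact: annotated_inst re _ (mem_head _ _).
- exact: inst_rules re.
- move=> _ /mapP[B Bl ->]; apply/mapP; exists (B, lpos r e B) => //.
  by apply: (annotated_inst re); rewrite inE; apply/orP; right; apply: map_f.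
by rewrite size_map.
Qed.

Lemma Gw_is_mcftg w : is_mcftg rk (Gw w).
Proof.
have bE : bigs (Gw w) = [seq bname id x.1 x.2 | x <- annotated w] by [].
have nE : nts (Gw w) = flatten [seq bname id x.1 x.2 | x <- annotated w] by [].
have rE : rules (Gw w) = [seq inst_rule x | x <- insts w] by [].
split; rewrite ?bE ?nE ?rE.
- move=> _ /mapP[[A v] xa ->]; have AG := annotated_bigs xa.
  rewrite [(A, v).1]/= [(A, v).2]/= in AG *.
  have [A0 uA _] := mcftg_bigs HG AG; split.
  + by case: (A) A0.
  + rewrite map_inj_in_uniq // => C D CA DA E.
    by case: (cname_inj AG AG CA DA E).
  by move=> X XA; apply/flatten_mapP; exists (A, v).
- move=> _ _ /mapP[[A v] xa ->] /mapP[[A' v'] xa' ->] E.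
  rewrite [(A, v).1]/= [(A, v).2]/= [(A', v').1]/= [(A', v').2]/= in E.
  have AG := annotated_bigs xa; have A'G := annotated_bigs xa'.
  have [A0 _ _] := mcftg_bigs HG AG.
  (* Each component name carries its big nonterminal and all positions, so one common component
     suffices. *)
  case: A xa AG A0 E => // C A xa AG _ /(_ (cname id (C :: A) v C)).
  rewrite mem_head => /esym/mapP[C' C'A'].
  by move/(cname_inj AG A'G (mem_head _ _) C'A') => [-> -> _].
- exact: mcftg_term HG.
- exact: mem_head.
- by rewrite /= unname_cname ?(mcftg_start_rank HG) ?(mcftg_start HG) ?mem_head.
- by move=> _ /mapP[[r e] re ->]; apply: (inst_is_rule re).
move=> _ _ /mapP[[r e] re ->] /mapP[[r' e'] re' ->] EA Eu El.
have rG := inst_rules re; have r'G := inst_rules re'.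
have [AA vv] := bname_inj (lhs_bigs rG) (lhs_bigs r'G) EA.
(* Erasing the positions with [unname] recovers the rule of G. *)
have uu : rhs r = rhs r'.
  have K (r0 : rule NT Sg) e0 : (r0, e0) \in insts w ->
      map (tmap (relabel unname)) (rhs (inst_rule (r0, e0))) = rhs r0.
    move=> re0; rewrite -map_comp -[RHS]map_id; apply/eq_in_map => u ur.
    apply: tmap_relabelK => C /(ntocc_links re0 ur); exact: unname_lname re0 C.
  by rewrite -(K r e re) Eu K.
have rr : r = r'.
  apply: (mcftg_link_order HG) => // B.
  have K (r0 : rule NT Sg) e0 : (r0, e0) \in insts w ->
      map (map unname) (links (inst_rule (r0, e0))) = links r0.
    move=> re0; rewrite -map_comp -[RHS]map_id; apply/eq_in_map => B' Bl.
    exact: unname_bname (link_bigs (inst_rules re0) Bl).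
  by rewrite -(K r e re) -(K r' e' re'); apply: eq_mem_map.
move: El EA Eu re' {r'G AA uu}; rewrite -rr => El EA Eu re'.
(* By [bname_inj], the only link of the other instance that can equal the annotated B is its own
   copy of B, so the positions coincide. *)
congr (_, _, _) => //; apply/eq_in_map => B Bl.
have : bname id B (lpos r e B) \in links (inst_rule (r, e')).
  by rewrite -El; apply: map_f.
case/mapP=> B' B'l /(bname_inj (link_bigs rG Bl) (link_bigs rG B'l))[-> E].
by rewrite E.
Qed.

Lemma lang_sound w X v : lang (Gw w) X v -> forall A al,
  A \in bigs G -> X = bname id A (vec al A) -> lang G A v /\ sem Delta b w al A v.
Proof.
elim=> {X v} rr f /mapP[[r e] re ->] _ IH A al AG.
have rG := inst_rules re; case/(bname_inj (lhs_bigs rG) AG) => <- /vecP agr.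
rewrite (fsubst_inst re) -map_comp.
set f' := f \o _.
have {}IH B : B \in links r -> lang G B (f' B) /\ sem Delta b w (posn r e false) B (f' B).
  move=> Bl; apply: (IH (bname id B (lpos r e B))) => //; first exact: map_f.
  exact: link_bigs Bl.
have Hl : lang G (lhs r) (fsubst (links r) (map f' (links r)) (rhs r)).
  by apply: LangRule => // B /IH[].
split=> //; apply: (sem_agree (lang_values Hl) agr); apply: (inst_sound HG rG _ re).
  apply: (all2_nthP (x0 := [::]) (t0 := [::])); first by rewrite size_map.
  move=> i ir; rewrite (nth_map [::]) //; apply: lang_values.
  by have [] := IH _ (mem_nth [::] ir).
apply: (all2_nthP (x0 := [::]) (t0 := [::])); first by rewrite size_map.
by move=> i ir; rewrite (nth_map [::]) //; have [] := IH _ (mem_nth [::] ir).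
Qed.

Lemma lang_complete w A v : lang G A v -> forall al,
  bounded w al -> sem Delta b w al A v -> lang (Gw w) (bname id A (vec al A)) v.
Proof.
elim=> {A v} r f rG Hf IH al nal Hs.
have Hv : all2 values (links r) (map f (links r)).
  apply: (all2_nthP (x0 := [::]) (t0 := [::])); first by rewrite size_map.
  move=> i ir; rewrite (nth_map [::]) //; apply: lang_values.
  exact: Hf (mem_nth [::] ir).
have [e [be [re agr nbe agrl Hl]]] := inst_complete HG rG Hv nal Hs.
have -> : vec al (lhs r) = rpos r e by apply/esym/vecP.
(* [LangRule] for G_w wants a function on annotated names; composing f with the erasure of positions
   provides it. *)
have fE B : B \in links r -> f (map unname (bname id B (lpos r e B))) = f B.
  by move=> Bl; rewrite (unname_bname _ (link_bigs rG Bl)).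
have -> : fsubst (links r) (map f (links r)) (rhs r)
    = fsubst (links (inst_rule (r, e)))
        (map (f \o map unname) (links (inst_rule (r, e))))
        (rhs (inst_rule (r, e))).
  rewrite (fsubst_inst re) -map_comp; congr fsubst; apply/eq_in_map => B Bl.
  by rewrite /= fE.
apply: (LangRule (r := inst_rule (r, e))); first exact: map_f.
move=> _ /mapP[B Bl ->] /=; rewrite fE //.
have -> : lpos r e B = vec be B.
  by apply/vecP => C CB; apply: agrl; apply/flattenP; exists B.
apply: IH => //; have := all2_nthE [::] [::] Hl; move/(_ (index B (links r))).
by rewrite index_mem => /(_ Bl); rewrite (nth_map [::]) ?index_mem // nth_index.
Qed.

Lemma bounded_al0 w : bounded w (al0 w).
Proof. by move=> C [] h /=. Qed.

Lemma sem_start w v : values [:: start G] v ->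
  sem Delta b w (al0 w) [:: start G] v <-> yd Delta v = w.
Proof.
case: v => [|t [|t' v]] //=; last by rewrite andbF.
rewrite andbT (mcftg_start_rank HG) => /andP[/perm_size/size0nil vt _].
rewrite /spansb /al0 /yd /flabels /= cats0 andbT.
have -> : glin (gaps b Sg (fun sd _ => if sd then size w else 0)) t = map Let (labels t).
  by rewrite /glin (tstr_labels vt) -map_comp; elim: (labels t) => //= a s ->.
by split=> [/eqP/run_word|/run_word/eqP].
Qed.

Lemma Hw_language w d :
  rtg_language (Hw w) d <-> derivation G d /\ yd Delta (dval d) = w.
Proof.
split=> [Hd|[Hd yw]].
  have [Gd Hs] := rtg_sound Hd (mcftg_start HG) erefl.
  by split=> //; apply/(sem_start w (der_values Gd)).
apply: rtg_complete (Hd) _ (bounded_al0 w) _.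
exact/(sem_start w (der_values Hd)).
Qed.

Lemma Gw_language w t :
  language (Gw w) t <-> language G t /\ yd Delta [:: t] = w.
Proof.
split=> [Ht|[Ht yw]].
  have [Gt Hs] := lang_sound Ht (mcftg_start HG) (al := al0 w) erefl.
  by split=> //; apply/(sem_start w (lang_values Gt)).
have := lang_complete Ht (bounded_al0 w); apply.
exact/(sem_start w (lang_values Ht)).
Qed.
End Grammars.

(** * The program *)

Definition K (c : nat) : expr := (0, c).

(** The functions [senc_...] mirror the encodings [enc_...] with expressions in place of numbers, so
    that the text is fixed before w is known. *)
Definition senc_seq (T : Type) (enc : T -> seq expr) (s : seq T) : seq expr :=
  flatten [seq K 1 :: enc x | x <- s] ++ [:: K 0].

Definition senc_name (v : seq expr) : seq expr := senc_seq (fun x => [:: x]) v.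

Lemma flatten_flatten_map (S T U : Type) (p : T -> seq U) (q : S -> seq T) l :
  flatten (map p (flatten (map q l))) = flatten [seq flatten (map p (q x)) | x <- l].
Proof. by elim: l => //= x l IH; rewrite map_cat flatten_cat IH. Qed.

Section Evaluation.
Variable e : seq nat.
Hypothesis e0 : nth 0 e 0 = 0.

Lemma ev_K c : ev e (K c) = c.
Proof. by rewrite /ev e0. Qed.

Lemma ev_items (T : eqType) (U : Type) (senc : T -> seq expr) (enc : U -> seq nat) f s :
  {in s, forall x, map (ev e) (senc x) = enc (f x)} ->
  map (ev e) (flatten [seq K 1 :: senc x | x <- s])
  = flatten [seq 1 :: enc y | y <- map f s].
Proof.
elim: s => //= x s IH H; rewrite map_cat ev_K H ?mem_head // IH // => y ys.
by apply: H; rewrite inE ys orbT.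
Qed.

Lemma ev_senc_seq (T : eqType) (U : Type) (senc : T -> seq expr) (enc : U -> seq nat) f s :
  {in s, forall x, map (ev e) (senc x) = enc (f x)} ->
  map (ev e) (senc_seq senc s) = enc_seq enc (map f s).
Proof. by move=> H; rewrite map_cat (ev_items H) /= ev_K. Qed.

Lemma ev_senc_name v : map (ev e) (senc_name v) = enc_name (map (ev e) v).
Proof. exact: ev_senc_seq. Qed.

Lemma ev_senc_names (vs : seq (seq expr)) :
  map (ev e) (senc_seq senc_name vs) = enc_seq enc_name (map (map (ev e)) vs).
Proof. by apply: ev_senc_seq => v _; apply: ev_senc_name. Qed.
End Evaluation.

Section Program.
Variables (Sg : finType) (rk : Sg -> nat) (NT : eqType) (G : mcftg NT Sg).
Variables (Delta : {set Sg}) (b : bool).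
Hypothesis HG : is_mcftg rk G.
Implicit Types (r : rule NT Sg) (A B : seq NT) (C : NT).

Local Notation insts := (insts G Delta b).
Local Notation Hw := (Hw G Delta b).
Local Notation Gw := (Gw G Delta b).
Local Notation vec := (vec G b).
Local Notation rname := (rname G).
Local Notation cname := (cname G).
Local Notation bname := (bname G).
Local Notation inst_bigs := (inst_bigs G Delta b).
Local Notation start_big := (start_big G b).

Definition svec r k A : seq expr :=
  vec (fun C sd h => where_is G Delta b r (k, C, sd, h)) A.

Definition slname r C : seq expr :=
  cname K (link_of r C) (svec r false (link_of r C)) C.

Fixpoint senc_tree r (t : tree (NT + Sg)) : seq expr :=
  match t with
  | Var i => [:: K 0; K i]
  | Node (inl C) ts => K 1 :: senc_name (slname r C) ++ senc_seq (senc_tree r) ts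
  | Node (inr a) ts => [:: K 2, K (enc_sym a) & senc_seq (senc_tree r) ts]
  end.

Definition sbigs r : seq (seq NT * seq expr) :=
  (lhs r, svec r true (lhs r)) :: [seq (B, svec r false B) | B <- links r].

(** The expressions (0, 0) and (1, 0) denote 0 and |w|, as in [al0]. *)
Definition sstart : seq NT * seq expr :=
  ([:: start G], vec (fun _ sd _ => if sd then (1, 0) else (0, 0)) [:: start G]).

Definition senc_rnt (x : seq NT * seq expr) := senc_name (rname K x.1 x.2).
Definition senc_big (x : seq NT * seq expr) := senc_seq senc_name (bname K x.1 x.2).
Definition senc_nts (x : seq NT * seq expr) :=
  flatten [seq K 1 :: senc_name (cname K x.1 x.2 C) ++ [:: K (ntrk G C)] | C <- x.1].

Definition senc_rrule r :=
  K 1 :: senc_name (rname K (lhs r) (svec r true (lhs r)))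
    ++ K (index r (rules G))
    :: senc_seq senc_name [seq rname K B (svec r false B) | B <- links r].

Definition senc_rule r :=
  K 1 :: senc_seq senc_name (bname K (lhs r) (svec r true (lhs r)))
    ++ senc_seq (senc_tree r) (rhs r)
    ++ senc_seq (senc_seq senc_name) [seq bname K B (svec r false B) | B <- links r].

Definition print_block (xs : seq expr) : block := (0, [::], xs).
(* A rule is printed in several places, each time by running through all its  *)
(* instances anew.                                                            *)
Definition rule_blocks (F : rule NT Sg -> seq expr) : seq block :=
  [seq (size (free_places G b r), rule_checks G Delta b r, F r) | r <- rules G].

Definition items (senc : seq NT * seq expr -> seq expr) r : seq expr :=
  flatten [seq K 1 :: senc x | x <- sbigs r].

(** A leading [K 0] ends the list printed by the preceding rule blocks; the entries of the start
    nonterminal are printed as fixed text. *)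
Definition blocks : seq block :=
  print_block (K 1 :: senc_rnt sstart) :: rule_blocks (items senc_rnt)
  ++ print_block (K 0 :: senc_rnt sstart) :: rule_blocks senc_rrule
  ++ print_block (K 0 :: senc_nts sstart)
  :: rule_blocks (fun r => flatten (map senc_nts (sbigs r)))
  ++ print_block (K 0 :: K 1 :: senc_big sstart) :: rule_blocks (items senc_big)
  ++ print_block (K 0 :: senc_name (cname K sstart.1 sstart.2 (start G)))
  :: rule_blocks senc_rule ++ [:: print_block [:: K 0]].

Lemma print_blockE (w : seq Sg) xs :
  block_out (enc_word w) (print_block xs) = map (ev [:: 0; size w]) xs.
Proof. by rewrite /block_out /instance_out /= size_map cats0. Qed.

Lemma rule_blocksE (w : seq Sg) F :
  flatten (map (block_out (enc_word w)) (rule_blocks F))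
  = flatten [seq map (ev x.2) (F x.1) | x <- insts w].
Proof.
rewrite /rule_blocks /insts -map_comp flatten_map_allpairs.
congr flatten; apply: eq_map => r; rewrite /block_out /instance_out /= size_map.
elim: (envs _ _) => //= e es IH; rewrite IH /env.
by case: (all _ _).
Qed.

Lemma map_vec (X Y : Type) (f : X -> Y) al A :
  map f (vec al A) = vec (fun C sd h => f (al C sd h)) A.
Proof. by rewrite /vec -map_comp. Qed.

Section InstanceText.
Variables (e : seq nat) (r : rule NT Sg).
Hypothesis e0 : nth 0 e 0 = 0.
Let evx (x : seq NT * seq expr) : seq NT * seq nat := (x.1, map (ev e) x.2).

Lemma map_rname A v : map (ev e) (rname K A v) = rname id A (map (ev e) v).
Proof. by rewrite /rname /= ev_K. Qed.

Lemma map_cname A v C : map (ev e) (cname K A v C) = cname id A (map (ev e) v) C.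
Proof. by rewrite /cname /rname /= !ev_K. Qed.

Lemma map_bname A v : map (map (ev e)) (bname K A v) = bname id A (map (ev e) v).
Proof.
by rewrite /bname -map_comp; apply: eq_map => C; apply: map_cname.
Qed.

Lemma inst_bigsE : inst_bigs (r, e) = map evx (sbigs r).
Proof.
rewrite /inst_bigs /sbigs /= -map_comp; congr ((_, _) :: _).
  by rewrite map_vec.
by apply: eq_map => B; rewrite /evx /= map_vec.
Qed.

Lemma ev_senc_rnt x : map (ev e) (senc_rnt x) = enc_name (rname id (evx x).1 (evx x).2).
Proof. by rewrite ev_senc_name // map_rname. Qed.

Lemma ev_senc_big x :
  map (ev e) (senc_big x) = enc_seq enc_name (bname id (evx x).1 (evx x).2).
Proof. by rewrite ev_senc_names // map_bname. Qed.

Lemma ev_senc_nts w x : x.1 \in bigs G -> map (ev e) (senc_nts x)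
  = flatten [seq 1 :: enc_name nm ++ [:: ntrk (Gw w) nm]
            | nm <- bname id (evx x).1 (evx x).2].
Proof.
move=> xG; rewrite /bname.
rewrite (@ev_items _ e0 _ _ _ (fun nm => enc_name nm ++ [:: ntrk (Gw w) nm])
  (cname id x.1 (map (ev e) x.2))) // => C Cx.
by rewrite map_cat ev_senc_name // map_cname /= ev_K // unname_cname.
Qed.

Lemma ev_senc_rrule : map (ev e) (senc_rrule r)
  = 1 :: let x := inst_rrule G Delta b (r, e) in
         enc_name x.1.1 ++ index x.1.2 (rules G) :: enc_seq enc_name x.2.
Proof.
rewrite /senc_rrule map_cons map_cat map_cons !ev_K // ev_senc_name // map_rname.
rewrite map_vec ev_senc_names // -map_comp; congr (_ :: _ ++ _ :: enc_seq _ _).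
by apply: eq_map => B; rewrite [LHS]map_rname map_vec.
Qed.

Lemma ev_senc_tree t : map (ev e) (senc_tree r t)
  = enc_tree (tmap (relabel (lname G Delta b r e)) t).
Proof.
elim/tree_ind_mem: t => [i|[C|a] ts IH]; first by rewrite /= !ev_K.
  rewrite -[senc_tree _ _]/(K 1 :: senc_name (slname r C) ++ senc_seq (senc_tree r) ts).
  rewrite map_cons map_cat ev_senc_name // /slname map_cname map_vec ev_K //.
  by rewrite (ev_senc_seq e0 (f := tmap (relabel (lname G Delta b r e))) IH).
rewrite /= !ev_K //.
by rewrite (ev_senc_seq e0 (f := tmap (relabel (lname G Delta b r e))) IH).
Qed.

Lemma ev_senc_rule : map (ev e) (senc_rule r)
  = 1 :: enc_rule (inst_rule G Delta b (r, e)).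
Proof.
rewrite /senc_rule map_cons map_cat ev_K // ev_senc_names // map_bname map_vec map_cat.
rewrite (ev_senc_seq e0 (in1W ev_senc_tree)).
rewrite (ev_senc_seq e0 (in1W (ev_senc_names e0))).
congr (_ :: _ ++ (_ ++ enc_seq _ _)).
by rewrite -map_comp; apply: eq_map => B; rewrite [LHS]map_bname map_vec.
Qed.
End InstanceText.

Lemma insts_env (w : seq Sg) x : x \in insts w -> nth 0 x.2 0 = 0.
Proof. by case/allpairsPdep=> r [e [_ _ ->]]. Qed.

Lemma start_bigE w : start_big w = (sstart.1, map (ev [:: 0; size w]) sstart.2).
Proof.
congr (_, _); rewrite [RHS]map_vec.
by apply: eq_map => -[C [[] h]]; rewrite /ev /= ?addn0.
Qed.

Lemma sbigs_bigs r : r \in rules G -> {in sbigs r, forall x, x.1 \in bigs G}.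
Proof.
move=> rG x; rewrite inE => /predU1P[->|/mapP[B Bl ->]].
  exact: (lhs_bigs HG rG).
exact: (link_bigs HG rG Bl).
Qed.

Lemma text_annotated (T : Type) (enc : T -> seq nat) f senc (w : seq Sg) :
  (forall e x, nth 0 e 0 = 0 -> x.1 \in bigs G ->
     map (ev e) (senc x) = flatten [seq 1 :: enc y | y <- f (x.1, map (ev e) x.2)]) ->
  enc_seq enc (flatten [seq f x | x <- annotated G Delta b w])
  = map (ev [:: 0; size w]) (senc sstart)
    ++ flatten [seq map (ev x.2) (flatten (map senc (sbigs x.1))) | x <- insts w]
    ++ [:: 0].
Proof.
move=> H; rewrite /enc_seq flatten_flatten_map /= start_bigE.
rewrite H ?(mcftg_start HG) // -catA; congr (_ ++ (_ ++ _)).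
rewrite flatten_flatten_map; congr flatten; apply/eq_in_map => -[r e] re.
have e0 := insts_env re; have rG := inst_rules re.
rewrite -[RHS]/(map (ev e) (flatten (map senc (sbigs r)))) map_flatten.
rewrite inst_bigsE -!map_comp; congr flatten.
by apply/eq_in_map => x xs /=; rewrite H // (sbigs_bigs rG).
Qed.

Lemma text_annotated1 (T : Type) (enc : T -> seq nat) f senc (w : seq Sg) :
  (forall e x, nth 0 e 0 = 0 ->
     map (ev e) (senc x) = enc (f (x.1, map (ev e) x.2))) ->
  enc_seq enc [seq f x | x <- annotated G Delta b w]
  = map (ev [:: 0; size w]) (K 1 :: senc sstart)
    ++ flatten [seq map (ev x.2) (items senc x.1) | x <- insts w]
    ++ [:: 0].
Proof.
move=> H; rewrite -flatten_map1 (text_annotated (senc := fun x => K 1 :: senc x)) //.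
by move=> e x e0 _; rewrite map_cons ev_K // H //= cats0.
Qed.

Lemma text_insts (T : Type) (enc : T -> seq nat) f senc (w : seq Sg) :
  (forall e r, nth 0 e 0 = 0 -> map (ev e) (senc r) = 1 :: enc (f (r, e))) ->
  enc_seq enc [seq f x | x <- insts w]
  = flatten [seq map (ev x.2) (senc x.1) | x <- insts w] ++ [:: 0].
Proof.
move=> H; rewrite /enc_seq -map_comp; congr (flatten _ ++ _).
by apply/eq_in_map => -[r e] re /=; rewrite H // (insts_env re).
Qed.

Lemma blocks_out (w : seq Sg) :
  flatten (map (block_out (enc_word w)) blocks)
  = enc_rtg (rules G) (Hw w) ++ enc_mcftg (Gw w).
Proof.
set e := [:: 0; size w].
have -> : enc_rtg (rules G) (Hw w) = 
    (map (ev e) (K 1 :: senc_rnt sstart)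
      ++ flatten [seq map (ev x.2) (items senc_rnt x.1) | x <- insts w] ++ [:: 0])
    ++ map (ev e) (senc_rnt sstart)
    ++ flatten [seq map (ev x.2) (senc_rrule x.1) | x <- insts w] ++ [:: 0].
  rewrite /enc_rtg; congr (_ ++ (_ ++ _)).
  - by apply: text_annotated1 => e' x e0; apply: ev_senc_rnt.
  - by rewrite ev_senc_rnt // -[rstart _]/(rname id _ (start_big w).2) start_bigE.
  by apply: text_insts => e' r e0; apply: ev_senc_rrule.
have -> : enc_mcftg (Gw w) = 
    (map (ev e) (senc_nts sstart)
      ++ flatten [seq map (ev x.2) (flatten (map senc_nts (sbigs x.1))) | x <- insts w]
      ++ [:: 0])
    ++ (map (ev e) (K 1 :: senc_big sstart)
      ++ flatten [seq map (ev x.2) (items senc_big x.1) | x <- insts w] ++ [:: 0])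
    ++ map (ev e) (senc_name (cname K sstart.1 sstart.2 (start G)))
    ++ flatten [seq map (ev x.2) (senc_rule x.1) | x <- insts w] ++ [:: 0].
  rewrite /enc_mcftg; congr (_ ++ (_ ++ (_ ++ _))).
  - by apply: text_annotated => e' x e0 xG; apply: ev_senc_nts.
  - by apply: text_annotated1 => e' x e0; apply: ev_senc_big.
  - by rewrite ev_senc_name // map_cname //
      -[start _]/(cname id _ (start_big w).2 _) start_bigE.
  by apply: text_insts => e' r e0; apply: ev_senc_rule.
have K0 xs : map (ev e) (K 0 :: xs) = [:: 0] ++ map (ev e) xs by [].
have step xs F bs :
    flatten (map (block_out (enc_word w)) (print_block xs :: rule_blocks F ++ bs))
    = map (ev e) xs ++ flatten [seq map (ev x.2) (F x.1) | x <- insts w]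
      ++ flatten (map (block_out (enc_word w)) bs).
  rewrite -[LHS]/(block_out _ (print_block xs)
    ++ flatten (map (block_out (enc_word w)) (rule_blocks F ++ bs))).
  by rewrite print_blockE map_cat flatten_cat rule_blocksE.
have stop : flatten (map (block_out (enc_word w)) [:: print_block [:: K 0]]) = [:: 0].
  by rewrite [LHS]cats0 print_blockE.
by rewrite /blocks !step stop !K0 -!catA.
Qed.

(** The left-hand side and each of the at most lambda links have at most mu components, with at most
    F free places each. *)
Lemma size_free_places (F : nat) r :
  r \in rules G -> {in nts G, forall C, fan G b C <= F} ->
  size (free_places G b r) <= mu G * F * (lambda G).+1.
Proof.
move=> rG HF; rewrite size_cat !size_allpairs_dep.
have bound A : A \in bigs G ->
    sumn [seq size (iota 0 (fan G b C)) | C <- A] <= mu G * F.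
  move=> AG; apply: (@leq_trans (size A * F)); last first.
    by rewrite leq_mul2r (leq_bigmax_seq (F := fun A : seq NT => size A)) ?orbT.
  have [_ _] := mcftg_bigs HG AG; elim: (A) => //= C A' IH sub.
  rewrite size_iota mulSn leq_add ?HF ?sub ?mem_head // IH // => D DA.
  by apply: sub; rewrite inE DA orbT.
rewrite mulnS leq_add ?bound ?(lhs_bigs HG) //.
apply: (@leq_trans (size (links r) * (mu G * F))); last first.
  rewrite mulnC leq_mul2l.
  by rewrite (leq_bigmax_seq (F := fun r : rule NT Sg => size (links r))) ?orbT.
have := rule_links (mcftg_rules HG rG); elim: (links r) => //= B Bs IH sub.
rewrite map_cat sumn_cat mulSn leq_add ?bound ?sub ?mem_head // IH // => D DB.
by apply: sub; rewrite inE DB orbT.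
Qed.

Lemma blocks_degree (F : nat) : 0 < F -> {in nts G, forall C, fan G b C <= F} ->
  maxn 1 (\max_(x <- blocks) x.1.1) <= mu G * F * (lambda G).+1.
Proof.
move=> F0 HF; rewrite geq_max !muln_gt0 F0 !andbT; apply/andP; split.
  (* The start nonterminal is a big nonterminal of length 1, so mu is positive. *)
  exact: (leq_bigmax_seq (F := fun A : seq NT => size A) _ (mcftg_start HG) isT).
set D := _ * _.
suff: all (fun x : block => x.1.1 <= D) blocks.
  by move=> /allP H; apply/bigmax_leqP_seq => x xb _; apply: H.
have all_rule F' : all (fun x : block => x.1.1 <= D) (rule_blocks F').
  by rewrite all_map; apply/allP => r rG; apply: size_free_places.
by rewrite /blocks /=; do 5!rewrite all_cat all_rule /=.
Qed.
End Program.

(** * The polynomial and the conclusion *)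

Lemma poly_bound (c D : nat) : exists p : {poly nat},
  size p = D.+1 /\ forall n, c * n.+1 ^ D <= p.[n]%R.
Proof.
(* Binomial expansion of (n + 1)^D; the factor c + 1 keeps the leading coefficient nonzero even for
   c = 0, so that the degree is exactly D. *)
exists (\poly_(i < D.+1) (c.+1 * 'C(D, i))%N)%R; split.
  by rewrite size_poly_eq //= binn muln1.
move=> n; rewrite horner_poly -add1n expnDn big_distrr /=.
rewrite [X in _ <= X](_ : _ = \sum_(i < D.+1) c.+1 * 'C(D, i) * n ^ i).
  by apply: leq_sum => i _; rewrite exp1n mul1n mulnA !leq_mul.
by apply: eq_bigr => i _; rewrite natrXE.
Qed.

Theorem theorem72 (Sg : finType) (rk : Sg -> nat) (NT : eqType)
    (G : mcftg NT Sg) (HG : is_mcftg rk G) (Delta : {set Sg}) :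
  exists (P : program)
         (H : seq Sg -> rtg name (rule NT Sg))
         (Gw : seq Sg -> mcftg name Sg)
         (time : seq Sg -> nat),
    [/\ forall w : seq Sg, {subset w <= Delta} ->
          [/\ runs P (enc_word w)
                (enc_rtg (rules G) (H w) ++ enc_mcftg (Gw w)) (time w),
              is_rtg (rules G) (@rule_arity NT Sg) (H w),
              is_mcftg rk (Gw w),
              forall d : tree (rule NT Sg),
                rtg_language (H w) d <-> derivation G d /\ yd Delta (dval d) = w
            & forall t : tree Sg,
                language (Gw w) t <-> language G t /\ yd Delta [:: t] = w],
        exists p : {poly nat},
          size p = (mu G * (theta G).+1 * (lambda G).+1).+1 /\
          (forall w : seq Sg, {subset w <= Delta} ->
             time w <= p.[size w]%R)
      & footed rk G ->
        exists p : {poly nat},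
          size p = (2 * mu G * (lambda G).+1).+1 /\
          (forall w : seq Sg, {subset w <= Delta} ->
             time w <= p.[size w]%R)].
Proof.
(* The mode is chosen by deciding whether G is footed, so that one program meets both bounds. *)
pose b := all (fun r => all (footed_pattern (symrk rk G)) (rhs r)) (rules G).
have Hb : b -> footed rk G by move/allP.
have [P [c HP]] := blocks_run (blocks G Delta b).
have code0 (w : seq Sg) : 0 \notin enc_word w by apply/mapP => -[].
set m := maxn 1 _ in HP.
(* [blocks_run] gives a running time for each input separately; choice turns these into a
   function. *)
have [time Htime] := functional_choice _ (fun w : seq Sg =>
  let: ex_intro2 t Hr Ht := HP (enc_word w) (code0 w) in ex_intro _ t (conj Hr Ht)).
have bound D : m <= D -> exists p : {poly nat}, size p = D.+1 /\
    (forall w : seq Sg, {subset w <= Delta} -> time w <= p.[size w]%R).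
  move=> mD; have [p [sp Hp]] := poly_bound c D; exists p; split=> // w _.
  have [_ Ht] := Htime w; apply: leq_trans Ht _; apply: leq_trans (Hp _).
  by rewrite size_map leq_mul2l leq_pexp2l ?orbT.
exists P, (Hw G Delta b), (Gw G Delta b), time; split.
- move=> w _; split.
  + by rewrite -(blocks_out Delta b HG); have [] := Htime w.
  + exact: Hw_is_rtg.
  + exact: (Gw_is_mcftg Delta b HG).
  + exact: (Hw_language Delta HG Hb).
  exact: (Gw_language Delta HG Hb).
- apply/bound/(blocks_degree Delta HG) => // C CG.
  (* In either mode C has at most rk(C) holes. *)
  have := leq_bigmax_seq (F := ntrk G) C CG isT; rewrite -/(theta G) ltnS.
  by apply: leq_trans; rewrite /nholes; case: ifP => // _; case: (ntrk G C).
(* The factor 2 counts slot 0 and the single hole of a footed pattern. *)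
move=> ft; rewrite [2 * _]mulnC; apply/bound/(blocks_degree Delta HG) => // C CG.
by rewrite /fan /nholes (_ : b) ?ltnS ?leq_b1 //; apply/allP.
Qed.
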